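(* In the setting of the context, for every bounded continuous function $\phi$ on $[0,1]$, $$\mathbb E\big|\langle\tilde U^n_{t_1},\phi\rangle-\langle\tilde U_{t_1},\phi\rangle\big|^2\to0\quad\text{as }n\to\infty.$$
   Context: Let $a>0$, $b\in\mathbb{R}$, $\alpha>0$, $\Delta>0$, $t_1=\Delta$. $\mathcal{X}$ is the space of finite nonnegative Borel measures on $[0,1]$ and $\langle\mu,\phi\rangle=\int_0^1\phi\,d\mu$. Put $c=-b/(2a)$, $\sigma_0=0$, $\sigma_j=a(c^2+(j\pi)^2)$, $\psi_0(x)=\sqrt{2c/(1-e^{-2c})}$, $\psi_j(x)=\sqrt2e^{cx}\sin(j\pi x+k_j)$, $k_j=\tan^{-1}(-j\pi/c)$, $P_t(y,x)=\sum_{j\ge0}e^{-\sigma_jt}\psi_j(y)\psi_j(x)$. The true parameter is $\theta_0=(\beta_0,\lambda_0)\in\Theta=\{(\beta,\lambda):0<\beta<1,0<\lambda\le M\}$. The signal $U(t,x)=e^{-\alpha t}\int_0^1P_t(y,x)U_0(dy)+\int_0^te^{-\alpha(t-s)}P_{t-s}(\beta_0,x)dN_{\lambda_0s}$ ($U_0$ an $\mathcal X$-valued random variable, $N$ an independent standard Poisson process) is observed through $Y_i=h(\langle U_{t_i},\phi_0\rangle)+\varepsilon_i$, $t_i=i\Delta$, with $h$ bounded continuous, $\phi_0$ bounded continuous or a Dirac delta on $[0,1]$, $\varepsilon_i$ i.i.d. $\mathcal N(0,1)$ independent of $N,U_0$. $\hat\theta_n=(\hat\beta_n,\hat\lambda_n)\in\Theta$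 is the moment estimator solving $n^{-1}\sum_{i\le n}Y_i=g_1(\theta)$, $n^{-1}\sum_{i\le n}Y_i^2=g_2(\theta)+1$, where $g_1(\theta)=\int h(\langle\nu,\phi_0\rangle)F_\theta(d\nu)$, $g_2(\theta)=\int h^2(\langle\nu,\phi_0\rangle)F_\theta(d\nu)$ and $F_\theta$ is the invariant law of the signal with parameter $\theta$; it is assumed that $g_1,g_2$ are continuously differentiable on $\Theta$ with nonvanishing Jacobian determinant there and that this solution exists uniquely with probability $1$ as $n\to\infty$ (so that $\hat\theta_n\to\theta_0$ a.s.). Let $\tilde U_0$ be an $\mathcal X$-valued random variable (in the paper, distributed as $U_0$, or as the filter $\Pi^n_{j-1}$) and $\tilde N$ a standard Poisson process independent of all other random objects. Define $\tilde U_{t_1}=e^{-\alpha t_1}\int_0^1P_{t_1}(y,\cdot)\tilde U_0(dy)+\int_0^{t_1}e^{-\alpha(t_1-s)}P_{t_1-s}(\beta_0,\cdot)d\tilde N_{\lambda_0s}$ and $\tilde U^n_{t_1}=e^{-\alpha t_1}\int_0^1P_{t_1}(y,\cdot)\tilde U_0(dy)+\int_0^{t_1}e^{-\alpha(t_1-s)}P_{t_1-s}(\hat\beta_n,\cdot)d\tilde N_{\hat\lambda_ns}$. *)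

(* Defs.v *)
From Stdlib Require Lists.List.
From HB Require Import structures.
From mathcomp Require Import all_boot all_order all_algebra.
From mathcomp Require Import all_classical all_reals all_analysis.
From mathcomp Require Import measurable_realfun.
Set Implicit Arguments. Unset Strict Implicit. Unset Printing Implicit Defensive.
Import Order.TTheory GRing.Theory Num.Theory.
Import numFieldNormedType.Exports.
Local Open Scope classical_set_scope.
Local Open Scope ring_scope.

Section model.
Context {R : realType}.

Definition cc (a b : R) : R := - b / (2 * a).

Definition sigmaj (a b : R) (j : nat) : R :=
  if j == 0%N then 0 else a * (cc a b ^+ 2 + (j%:R * pi) ^+ 2).

(* k_j = atan(-j pi / c); for c = 0 we use the limiting value -pi/2 *)
Definition kj (a b : R) (j : nat) : R :=
  if cc a b == 0 then - (pi / 2) else atan (- (j%:R * pi) / cc a b).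

(* psi_0 = sqrt(2c/(1-e^{-2c})) (= 1 in the limit c = 0),
   psi_j(x) = sqrt 2 e^{cx} sin(j pi x + k_j) *)
Definition psi (a b : R) (j : nat) (x : R) : R :=
  if j == 0%N then
    (if cc a b == 0 then 1
     else Num.sqrt (2 * cc a b / (1 - expR (- (2 * cc a b)))))
  else Num.sqrt 2 * expR (cc a b * x) * sin (j%:R * pi * x + kj a b j).

Definition Pker (a b t y x : R) : R :=
  limn (series (fun j : nat =>
    expR (- (sigmaj a b j * t)) * psi a b j y * psi a b j x)).

Context {d : measure_display} {T : measurableType d} (P : probability T R).

Definition arrival (E : nat -> T -> R) (k : nat) (w : T) : R :=
  \sum_(i < k.+1) E i w.

Definition mutually_independent (I : Type) (X : I -> T -> R) : Prop :=
  forall (s : seq I) (B : I -> set R), Stdlib.Lists.List.NoDup s -> (forall i, measurable (B i)) ->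
    P (\bigcap_(i in [set i | Stdlib.Lists.List.In i s]) (X i @^-1` B i)) =
    (\prod_(i <- s) P (X i @^-1` B i))%E.

Definition independent_families (I J : Type) (X : I -> T -> R) (Y : J -> T -> R)
  : Prop :=
  forall (s : seq I) (s' : seq J) (B : I -> set R) (C : J -> set R),
    (forall i, measurable (B i)) -> (forall j, measurable (C j)) ->
    P ((\bigcap_(i in [set i | Stdlib.Lists.List.In i s]) (X i @^-1` B i)) `&`
       (\bigcap_(j in [set j | Stdlib.Lists.List.In j s']) (Y j @^-1` C j))) =
    (P (\bigcap_(i in [set i | Stdlib.Lists.List.In i s]) (X i @^-1` B i)) *
     P (\bigcap_(j in [set j | Stdlib.Lists.List.In j s']) (Y j @^-1` C j)))%E.

Definition std_poisson_interarrivals (E : nat -> T -> R) : Prop :=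
  (forall k, measurable_fun setT (E k)) /\
  mutually_independent E /\
  (forall k B, measurable B -> P (E k @^-1` B) = exponential_prob 1 B).

(* density (in x) of
   e^{-alpha t} int_0^1 P_t(y,x) U0(dy) + int_0^t e^{-alpha(t-s)} P_{t-s}(beta,x) dN_{lambda s}
   where N has arrival times tau_k, so that s |-> N_{lambda s} jumps at tau_k/lambda *)
Definition Udens (a b alpha t : R) (U0 : set R -> \bar R) (E : nat -> T -> R)
  (beta lambda : R) (w : T) (x : R) : R :=
  expR (- (alpha * t)) * fine (\int[U0]_(y in `[0, 1]) (Pker a b t y x)%:E) +
  limn (series (fun k : nat =>
    let s := arrival E k w / lambda in
    if s <= t then expR (- (alpha * (t - s))) * Pker a b (t - s) beta x else 0)).

Definition pairing (f phi : R -> R) : R :=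
  Rintegral lebesgue_measure `[0, 1] (fun x => f x * phi x).

End model.

(* Main.v *)
(** Integrated against [phi], the kernel [P_u(beta, .)] gives
    [G(beta, u) = e^(-alpha u) sum_j e^(-sigma_j u) psi_j(beta) <psi_j, phi>].
    By Cauchy-Schwarz and Bessel's inequality [|G(beta, u)| <= C u^(-1/4)], and [G] is
    continuous on [u > 0]. The contributions of [U_0] cancel, so the difference to be
    estimated is almost surely the finite sum over the arrival times [tau_k] of
    [G(beta_n, t - tau_k / lambda_n) - G(beta_0, t - tau_k / lambda_0)], which tends to [0]
    almost surely. Its square is controlled by a weighted Cauchy-Schwarz inequality and
    is uniformly integrable: the first inter-arrival time has density at most [1] and is
    independent of the others and of [lambda_n], so that [lambda_n t - tau_k] lies in
    an interval [[0, h]] with probability at most [2 h r^k], [r < 1], whereas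
    [G^2] is only as singular as [u^(-1/2)]. *)

Require Import Defs.
From HB Require Import structures.
From mathcomp Require Import all_boot all_order all_algebra.
From mathcomp Require Import all_classical all_reals all_analysis.
From mathcomp Require Import measurable_realfun.
From mathcomp Require Import ring lra.
Set Implicit Arguments. Unset Strict Implicit. Unset Printing Implicit Defensive.
Import Order.TTheory GRing.Theory Num.Theory.
Import numFieldNormedType.Exports.
Local Open Scope classical_set_scope.
Local Open Scope ring_scope.

(** * Series with a geometric majorant *)

(** The obstacle is that [lambda_n] is random and varies with [n]: the singularity of the kernel at
    [u = 0] is approached at times that move with [n], and no integrable majorant common to all [n]
    is at hand. Each squared jump contribution is therefore cut at the scale [u = 16^-m]. Above the
    cut, [C 4^m] on the event that the jump occurs is a majorant free of [n]. Below it the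
    expectation is of order [4^-m] uniformly in [n], because at the scale [u ~ 16^-l] a height of
    order [4^l] meets a probability of order [16^-l]. The balance rests on the square summability of
    the coefficients [<psi_j, phi>]: bounding them by a constant would only give [G^2 <= C / u],
    which is not integrable at [0]. The number of jumps is random too. The event [tau_k <= lambda t]
    is enlarged to the event that the first [k + 1] inter-arrival times are all at most [L = M t].
    This event has product form, serves all admissible [lambda] at once and has probability
    [r^(k+1)] with [r = 1 - e^-L]. *)

Lemma sqr_sum_mul_le (R : realFieldType) (u v : nat -> R) (n : nat) :
  (\sum_(0 <= i < n) u i * v i) ^+ 2 <=
  (\sum_(0 <= i < n) u i ^+ 2) * (\sum_(0 <= i < n) v i ^+ 2).
Proof.
set A := \sum_(0 <= i < n) u i ^+ 2; set B := \sum_(0 <= i < n) v i ^+ 2.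
set S := \sum_(0 <= i < n) u i * v i.
have B0 : 0 <= B by apply: sumr_ge0 => i _; exact: sqr_ge0.
(* The sum of the squares [(u i + x * v i) ^ 2], a quadratic polynomial in [x]; it is evaluated at
   its minimiser [- S / B]. *)
have key x : 0 <= A + x * (2 * S) + x ^+ 2 * B.
  rewrite /A /B /S !mulr_sumr -!big_split/=.
  apply: sumr_ge0 => i _.
  suff -> : u i ^+ 2 + x * (2 * (u i * v i)) + x ^+ 2 * v i ^+ 2 = (u i + x * v i) ^+ 2 by exact: sqr_ge0.
  ring.
have [B00|Bn0] := eqVneq B 0; last first.
  have Bp : 0 < B by rewrite lt_neqAle eq_sym Bn0.
  have := key (- S / B).
  rewrite (_ : _ + _ = (A * B - S ^+ 2) / B); last by field.
  by rewrite pmulr_lge0 ?invr_gt0// subr_ge0.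
(* With [B = 0] the polynomial is affine, and for [S != 0] this [x] would give it the value [-1]. *)
have := key (- (A + 1) / (2 * S)).
have [->|S0] := eqVneq S 0; first by move=> _; rewrite B00 expr0n/= mulr0.
rewrite B00 mulr0 addr0 mulfVK ?mulf_neq0//.
by rewrite opprD addrA subrr add0r ler0N1.
Qed.

Section geometric_domination.
Context {R : realType}.
Implicit Types (u l : nat -> R) (C z : R).

Lemma series_geometric_le C z n : 0 <= C -> 0 <= z < 1 ->
  \sum_(0 <= k < n) C * z ^+ k <= C / (1 - z).
Proof.
move=> C0 /andP[z0 z1].
have -> : \sum_(0 <= k < n) C * z ^+ k = C * (1 - z ^+ n) / (1 - z).
  by have /(congr1 (@^~ n)) := geometric_seriesE C (negbT (lt_eqF z1)).
rewrite ler_pM2r ?invr_gt0 ?subr_gt0// ler_piMr// lerBlDr lerDl.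
exact: exprn_ge0.
Qed.

Lemma geometric_dominated_cvg u C z : 0 <= z < 1 ->
  (forall j, `|u j| <= C * z ^+ j) -> cvgn (series u).
Proof.
move=> /andP[z0 z1] uC; apply: normed_cvg.
apply: series_le_cvg (uC) _ => [j|j|] //.
  exact: le_trans (uC j).
apply: is_cvg_geometric_series.
by rewrite ger0_norm.
Qed.

Lemma geometric_dominated_sum_le u C z n : 0 <= z < 1 ->
  (forall j, `|u j| <= C * z ^+ j) -> `|series u n| <= C / (1 - z).
Proof.
move=> z01 uC; have C0 : 0 <= C by have := uC 0%N; rewrite expr0 mulr1; apply: le_trans.
rewrite (le_trans (ler_norm_sum _ _ _))// (le_trans _ (series_geometric_le n C0 z01))//.
exact: ler_sum.
Qed.

Lemma geometric_dominated_lim_le u C z : 0 <= z < 1 ->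
  (forall j, `|u j| <= C * z ^+ j) -> `|limn (series u)| <= C / (1 - z).
Proof.
move=> z01 uC; have cu := geometric_dominated_cvg z01 uC.
rewrite -(cvg_lim _ (cvg_norm cu))//.
apply: limr_le; first exact: is_cvg_norm.
by apply: nearW => n; exact: geometric_dominated_sum_le.
Qed.

Lemma geometric_dominated_tail u C z J : 0 <= z < 1 ->
  (forall j, `|u j| <= C * z ^+ j) ->
  `|limn (series u) - series u J| <= C * z ^+ J / (1 - z).
Proof.
move=> z01 uC; have cu := geometric_dominated_cvg z01 uC.
have -> : limn (series u) - series u J = limn (fun n => series u (n + J)%N - series u J).
  apply/esym/cvg_lim => //; apply: cvgB; last exact: cvg_cst.
  by rewrite (cvg_shiftn J (series u)).
have -> : (fun n => series u (n + J)%N - series u J) = series (fun n => u (n + J)%N).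
  apply/funext => n; rewrite /series/= (big_cat_nat (leq0n J) (leq_addl n J))/= addrAC subrr add0r.
  by rewrite -{1}(add0n J) big_addn addnK.
apply: geometric_dominated_lim_le => // j.
by rewrite (le_trans (uC _))// -mulrA -exprD addnC.
Qed.

(* Tannery's theorem for a geometric majorant. *)
Lemma geometric_dominated_cvg_lim (a : nat -> nat -> R) l C z : 0 <= z < 1 ->
  (\forall n \near \oo, forall j, `|a n j| <= C * z ^+ j) ->
  (forall j, a n j @[n --> \oo] --> l j) ->
  limn (series (a n)) @[n --> \oo] --> limn (series l).
Proof.
move=> z01 aC al.
have lC j : `|l j| <= C * z ^+ j.
  rewrite -(cvg_lim _ (cvg_norm (al j)))//.
  apply: limr_le; first by apply: is_cvg_norm; apply: cvgP (al j).
  by near=> n; near: n; move: aC; apply: filterS => n; exact.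
have [z0 z1] := andP z01.
have C0 : 0 <= C by have := lC 0%N; rewrite expr0 mulr1; apply: le_trans.
apply/cvgrPdist_le => e e0.
have : C * z ^+ J / (1 - z) @[J --> \oo] --> (0 : R).
  rewrite -(mul0r (1 - z)^-1); apply: cvgMr_tmp.
  by apply: (@cvg_geometric R C z); rewrite ger0_norm.
have e3 : 0 < e / 3 by rewrite divr_gt0.
(* [J] depends on the majorant alone, so one truncation serves the limit and all large [n]. *)
move=> /cvgrPdist_le/(_ _ e3)[J _ /(_ J (leqnn J))/=].
rewrite sub0r normrN => tJ.
have {}tJ : C * z ^+ J / (1 - z) <= e / 3 := le_trans (ler_norm _) tJ.
have : series (a n) J @[n --> \oo] --> series l J.
  by apply: cvg_big => //; exact: add_continuous.
move=> /cvgrPdist_le/(_ _ e3) sJ.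
near=> n.
have anC : forall j, `|a n j| <= C * z ^+ j by near: n.
have h1 := le_trans (geometric_dominated_tail J z01 lC) tJ.
have h2 := le_trans (geometric_dominated_tail J z01 anC) tJ.
have h3 : `|series l J - series (a n) J| <= e / 3 by near: n.
rewrite (_ : _ - _ = (limn (series l) - series l J) +
  (series l J - series (a n) J) - (limn (series (a n)) - series (a n) J)); last by ring.
rewrite (le_trans (ler_normB _ _))// (le_trans (lerD (ler_normD _ _) h2))//.
lra.
Unshelve. all: by end_near. Qed.

End geometric_domination.

(** * Bounded measurable functions and Bessel's inequality *)

Section bounded_measurable.
Context d (T : measurableType d) (R : realType).
Variables (mu : {measure set T -> \bar R}) (D : set T).
Hypotheses (mD : measurable D) (finD : (mu D < +oo)%E).

(** Unlike integrability, this property is stable under products, and it implies integrability on a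
    set of finite measure. *)
Definition bounded_measurable (f : T -> R) :=
  measurable_fun D f /\ exists C, forall x, D x -> `|f x| <= C.

Lemma bounded_measurable_cst c : bounded_measurable (fun=> c).
Proof. by split; [exact: measurable_cst|exists `|c|]. Qed.

Lemma bounded_measurableD f g : bounded_measurable f -> bounded_measurable g ->
  bounded_measurable (fun x => f x + g x).
Proof.
move=> [mf [A fA]] [mg [B gB]]; split; first exact: measurable_funD.
by exists (A + B) => x Dx; rewrite (le_trans (ler_normD _ _))// lerD ?fA ?gB.
Qed.

Lemma bounded_measurableM f g : bounded_measurable f -> bounded_measurable g ->
  bounded_measurable (fun x => f x * g x).
Proof.
move=> [mf [A fA]] [mg [B gB]]; split; first exact: measurable_funM.
by exists (A * B) => x Dx; rewrite normrM ler_pM// ?fA ?gB.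
Qed.

Lemma bounded_measurableZ c f : bounded_measurable f ->
  bounded_measurable (fun x => c * f x).
Proof. by move=> ?; apply: bounded_measurableM => //; exact: bounded_measurable_cst. Qed.

Lemma bounded_measurableB f g : bounded_measurable f -> bounded_measurable g ->
  bounded_measurable (fun x => f x - g x).
Proof.
move=> [mf [A fA]] [mg [B gB]]; split; first exact: measurable_funB.
by exists (A + B) => x Dx; rewrite (le_trans (ler_normB _ _))// lerD ?fA ?gB.
Qed.

Lemma bounded_measurable_sum (f : nat -> T -> R) n :
  (forall j, bounded_measurable (f j)) ->
  bounded_measurable (fun x => \sum_(0 <= j < n) f j x).
Proof.
move=> bf; elim: n => [|n IH].
  by under eq_fun do rewrite big_geq//; exact: bounded_measurable_cst.
by under eq_fun do rewrite big_nat_recr//=; exact: bounded_measurableD.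
Qed.

Lemma bounded_measurable_integrable f :
  bounded_measurable f -> mu.-integrable D (EFin \o f).
Proof.
move=> [mf [C fC]]; apply: measurable_bounded_integrable => //.
exists C; split; first exact: num_real.
by move=> M CM x Dx /=; rewrite (le_trans (fC x Dx))// ltW.
Qed.

Lemma Rintegral_sum_nat (f : nat -> T -> R) n :
  (forall j, bounded_measurable (f j)) ->
  Rintegral mu D (fun x => \sum_(0 <= j < n) f j x) =
  \sum_(0 <= j < n) Rintegral mu D (f j).
Proof.
move=> bf; elim: n => [|n IH].
  rewrite big_geq//; under eq_Rintegral do rewrite big_geq//.
  by rewrite Rintegral_cst// mul0r.
rewrite big_nat_recr//= -IH -RintegralD//.
- by apply: eq_Rintegral => x _; rewrite big_nat_recr.
- by apply: bounded_measurable_integrable; exact: bounded_measurable_sum.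
- exact: bounded_measurable_integrable.
Qed.

Lemma normr_Rintegral_le (f : T -> R) (C : R) : measurable_fun D f ->
  (forall x, D x -> `|f x| <= C) ->
  `|Rintegral mu D f| <= C * fine (mu D).
Proof.
move=> mf fC.
have bf : bounded_measurable f by split=> //; exists C.
rewrite (le_trans (le_normr_Rintegral mD (bounded_measurable_integrable bf)))//.
rewrite -(Rintegral_cst _ mD) le_Rintegral//.
- apply: (bounded_measurable_integrable (f := fun x => `|f x|)); split.
    exact: measurableT_comp.
  by exists C => x Dx; rewrite normr_id fC.
- exact: (bounded_measurable_integrable (bounded_measurable_cst C)).
Qed.

Section series.
Variables (f : nat -> T -> R) (C z : R).
Hypotheses (z01 : 0 <= z < 1) (mf : forall j, measurable_fun D (f j)).
Hypothesis fC : forall x, D x -> forall j, `|f j x| <= C * z ^+ j.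

Lemma measurable_fun_series n : measurable_fun D (fun x => series (f^~ x) n).
Proof. by apply: measurable_sum => j; exact: mf. Qed.

Lemma bounded_measurable_limn_series :
  bounded_measurable (fun x => limn (series (f^~ x))).
Proof.
split; last first.
  by exists (C / (1 - z)) => x Dx; apply: geometric_dominated_lim_le => // j; exact: fC.
apply: (@measurable_fun_cvg _ _ _ _ (fun n x => series (f^~ x) n)) => // [n|x Dx].
  exact: measurable_fun_series.
by apply: (geometric_dominated_cvg z01 (C := C)); exact: fC.
Qed.

(** Dominated convergence applies because all partial sums are bounded by the constant
    [C / (1 - z)], integrable on a set of finite measure. *)
Lemma Rintegral_series :
  Rintegral mu D (fun x => limn (series (f^~ x))) =
  limn (series (fun j => Rintegral mu D (f j))).
Proof.
have [mlim _] := bounded_measurable_limn_series.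
have bf j : bounded_measurable (f j).
  by split=> //; exists (C * z ^+ j) => x Dx; exact: fC.
have [|||||_ _] := @dominated_convergence _ _ _ mu _ mD
  (fun n x => (series (f^~ x) n)%:E) (fun x => (limn (series (f^~ x)))%:E)
  (fun=> (C / (1 - z))%:E).
- by move=> n; apply/measurable_EFinP; exact: measurable_fun_series.
- exact/measurable_EFinP.
- apply: aeW => x Dx; apply: cvg_EFin; first exact: nearW.
  exact: geometric_dominated_cvg z01 (fC Dx).
- exact: bounded_measurable_integrable (bounded_measurable_cst _).
- apply: aeW => x n Dx; rewrite lee_fin.
  exact: geometric_dominated_sum_le z01 (fC Dx).
rewrite -[X in _ --> X -> _]fineK; last first.
  apply: integrable_fin_num => //.
  exact: bounded_measurable_integrable bounded_measurable_limn_series.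
move=> /fine_cvg cv; apply/esym/cvg_lim => //.
apply: cvg_trans cv; apply: near_eq_cvg; apply: nearW => n.
by rewrite /= /series/= -Rintegral_sum_nat.
Qed.

End series.

Section bessel.
Variables (e : nat -> T -> R) (h : R) (f : T -> R).
Hypotheses (h0 : 0 < h) (be : forall j, bounded_measurable (e j)).
Hypothesis orth : forall i j, Rintegral mu D (fun x => e i x * e j x) = (i == j)%:R * h.
Hypothesis bf : bounded_measurable f.

Let c j := Rintegral mu D (fun x => f x * e j x).
(** The residual of [f] after removing its projections on the first [n] functions. These have common
    squared norm [h], kept general because it is [1/2] for the cosines and sines below. *)
Let F n x := f x - \sum_(0 <= j < n) c j / h * e j x.

Let bF n : bounded_measurable (F n).
Proof.
apply: bounded_measurableB => //; apply: bounded_measurable_sum => j.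
exact: bounded_measurableZ.
Qed.

Let FS n x : F n.+1 x = F n x - c n / h * e n x.
Proof. by rewrite /F big_nat_recr//= opprD addrA. Qed.

Let Fe n m : (n <= m)%N -> Rintegral mu D (fun x => F n x * e m x) = c m.
Proof.
elim: n => [_|n IH nm].
  by apply: eq_Rintegral => x _; rewrite /F big_geq// subr0.
under eq_Rintegral do rewrite FS mulrBl -(mulrA (c n / h)).
rewrite RintegralB//; last 2 first.
- by apply: bounded_measurable_integrable; exact: bounded_measurableM.
- apply: bounded_measurable_integrable; apply: bounded_measurableZ.
  exact: bounded_measurableM.
rewrite RintegralZl//; last by apply: bounded_measurable_integrable; exact: bounded_measurableM.
by rewrite orth ltn_eqF// mul0r mulr0 subr0 IH// ltnW.
Qed.

(** Pythagoras: since the residual keeps the coefficient [c n], removing the next projection lowers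
    the squared norm by exactly [c n ^+ 2 / h]. *)
Let FF n : Rintegral mu D (fun x => F n x ^+ 2) =
  Rintegral mu D (fun x => f x ^+ 2) - h^-1 * \sum_(0 <= j < n) c j ^+ 2.
Proof.
elim: n => [|n IH].
  rewrite big_geq// mulr0 subr0.
  by apply: eq_Rintegral => x _; rewrite /F big_geq// subr0.
have bFF := bounded_measurableM (bF n) (bF n).
have bFe := bounded_measurableM (bF n) (be n).
have bee := bounded_measurableM (be n) (be n).
transitivity (Rintegral mu D (fun x => F n x * F n x + ((- (2 * (c n / h))) * (F n x * e n x)
    + (c n / h) ^+ 2 * (e n x * e n x)))).
  by apply: eq_Rintegral => x _; rewrite FS; ring.
rewrite RintegralD//; [|exact: bounded_measurable_integrable|]; last first.
  by apply: bounded_measurable_integrable; apply: bounded_measurableD; exact: bounded_measurableZ.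
rewrite RintegralD//; [|apply: bounded_measurable_integrable; exact: bounded_measurableZ..].
rewrite !RintegralZl//; [|exact: bounded_measurable_integrable..].
rewrite Fe// orth eqxx big_nat_recr//=.
move: IH; under eq_Rintegral do rewrite expr2.
move=> ->; field.
by rewrite gt_eqF.
Qed.

Lemma bessel_inequality n : \sum_(0 <= j < n) c j ^+ 2 <= h * Rintegral mu D (fun x => f x ^+ 2).
Proof.
have : 0 <= Rintegral mu D (fun x => F n x ^+ 2).
  by apply: Rintegral_ge0 => x _; exact: sqr_ge0.
by rewrite FF subr_ge0 mulrC ler_pdivrMr// mulrC.
Qed.

End bessel.

End bounded_measurable.

(** * Orthogonality of the cosine and sine systems on the unit interval *)

Section unit_interval.
Context {R : realType}.
Notation mu := (@lebesgue_measure R).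
Notation D := (`[0%R, 1%R]%classic : set R).

Lemma lebesgue_measure01 : mu D = 1%E.
Proof. by rewrite lebesgue_measure_itv/= lte01 oppr0 adde0. Qed.

Lemma lebesgue_measure01_lty : (mu D < +oo)%E.
Proof. by rewrite lebesgue_measure01 ltry. Qed.

Lemma continuous_bounded_measurable (f : R -> R) :
  {within D, continuous f} -> bounded_measurable D f.
Proof.
move=> cf; split.
  exact: subspace_continuous_measurable_fun.
have [M [_ fM]] := compact_bounded (continuous_compact cf (@segment_compact _ _ _)).
exists (M + 1) => x Dx; apply: fM; first by rewrite ltrDl.
by exists x.
Qed.

Lemma continuousT_bounded_measurable (f : R -> R) :
  continuous f -> bounded_measurable D f.
Proof. by move=> cf; apply: continuous_bounded_measurable; exact: continuous_subspaceT. Qed.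

Lemma sin_natpi n : sin (n%:R * pi) = 0 :> R.
Proof.
elim: n => [|n IH]; first by rewrite mul0r sin0.
by rewrite -natr1 mulrDl mul1r sinD IH sinpi mul0r mulr0 addr0.
Qed.

Lemma continuous_cosM (w : R) : continuous (fun x : R => cos (w * x)).
Proof.
move=> x; apply: (@continuous_comp _ _ _ (fun x => w * x) cos); last exact: continuous_cos.
by apply: cvgM; [exact: cvg_cst|exact: cvg_id].
Qed.

Lemma continuous_sinM (w : R) : continuous (fun x : R => sin (w * x)).
Proof.
move=> x; apply: (@continuous_comp _ _ _ (fun x => w * x) sin); last exact: continuous_sin.
by apply: cvgM; [exact: cvg_cst|exact: cvg_id].
Qed.

Lemma Rintegral_cos_natpi n : (0 < n)%N ->
  Rintegral mu D (fun x => cos (n%:R * pi * x)) = 0.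
Proof.
move=> n0; set w := n%:R * pi.
have w0 : w != 0 by rewrite mulf_neq0 ?pnatr_eq0 ?gt_eqF// pi_gt0.
pose F x : R := sin (w * x) / w.
have dF (x : R) : is_derive x (1 : R) F (cos (w * x)).
  rewrite /F; apply: is_derive_eq.
  by rewrite /GRing.scale/= mulr1; field.
have cF : continuous F.
  by move=> x; apply/differentiable_continuous/derivable1_diffP; exact: ex_derive.
rewrite /Rintegral (@continuous_FTC2 _ _ F 0 1 ltr01).
- by rewrite -EFinB/= /F mulr0 mulr1 sin0 sin_natpi !mul0r subrr.
- by apply: continuous_subspaceT; exact: continuous_cosM.
- split=> [x _||]; first exact: ex_derive.
    exact/cvg_at_right_filter/cF.
  exact/cvg_at_left_filter/cF.
- by move=> x _; rewrite derive1E; exact: derive_val.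
Qed.

Lemma Rintegral_cos_subn i j :
  Rintegral mu D (fun x => cos (i%:R * pi * x - j%:R * pi * x)) = (i == j)%:R.
Proof.
have [->|ij] := eqVneq i j.
  under eq_Rintegral do rewrite subrr cos0.
  by rewrite Rintegral_cst// mul1r; exact: (congr1 fine lebesgue_measure01).
wlog ji : i j ij / (j < i)%N => [hw|].
  have [/hw|ij'] := ltnP j i; first exact.
  under eq_Rintegral do rewrite -cosN opprB.
  by apply: hw; rewrite 1?eq_sym// ltn_neqAle ij.
rewrite -[RHS](@Rintegral_cos_natpi (i - j)%N) ?subn_gt0//.
apply: eq_Rintegral => x _; congr cos.
by rewrite (natrB _ (ltnW ji)) !mulrBl.
Qed.

Lemma Rintegral_cos_addn i j :
  Rintegral mu D (fun x => cos (i.+1%:R * pi * x + j.+1%:R * pi * x)) = 0.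
Proof.
rewrite -[RHS](@Rintegral_cos_natpi (i.+1 + j.+1)%N)//.
apply: eq_Rintegral => x _; congr cos.
by rewrite natrD !mulrDl.
Qed.

(** The sum frequency is never zero and integrates to [0] whatever [c] is; the product formulas use
    [c = 1/2] for cosines and [c = -1/2] for sines. *)
Lemma Rintegral_cos_subn_addn c i j :
  Rintegral mu D (fun x => 2^-1 * cos (i.+1%:R * pi * x - j.+1%:R * pi * x) +
    c * cos (i.+1%:R * pi * x + j.+1%:R * pi * x)) = (i == j)%:R * 2^-1.
Proof.
have cD (w v : R) : continuous (fun x : R => cos (w * x + v * x)).
  by under eq_fun do rewrite -mulrDl; exact: continuous_cosM.
have cB (w v : R) : continuous (fun x : R => cos (w * x - v * x)).
  by under eq_fun do rewrite -mulrBl; exact: continuous_cosM.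
have fin := @lebesgue_measure01_lty.
rewrite RintegralD//; last 2 first.
- apply: bounded_measurable_integrable => //.
  by apply: bounded_measurableZ; exact: continuousT_bounded_measurable.
- apply: bounded_measurable_integrable => //.
  by apply: bounded_measurableZ; exact: continuousT_bounded_measurable.
rewrite !RintegralZl//; last 2 first.
- by apply: bounded_measurable_integrable => //; exact: continuousT_bounded_measurable.
- by apply: bounded_measurable_integrable => //; exact: continuousT_bounded_measurable.
by rewrite Rintegral_cos_subn Rintegral_cos_addn mulr0 addr0 mulrC eqSS.
Qed.

Lemma Rintegral_cos_cos i j :
  Rintegral mu D (fun x => cos (i.+1%:R * pi * x) * cos (j.+1%:R * pi * x)) = (i == j)%:R * 2^-1.
Proof.
rewrite -(Rintegral_cos_subn_addn 2^-1).
by apply: eq_Rintegral => x _; rewrite cosB cosD; field.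
Qed.

Lemma Rintegral_sin_sin i j :
  Rintegral mu D (fun x => sin (i.+1%:R * pi * x) * sin (j.+1%:R * pi * x)) = (i == j)%:R * 2^-1.
Proof.
rewrite -(Rintegral_cos_subn_addn (- 2^-1)).
by apply: eq_Rintegral => x _; rewrite cosB cosD; field.
Qed.

Lemma bessel_cos (f : R -> R) n : bounded_measurable D f ->
  \sum_(0 <= j < n) (Rintegral mu D (fun x => f x * cos (j.+1%:R * pi * x))) ^+ 2 <=
  2^-1 * Rintegral mu D (fun x => f x ^+ 2).
Proof.
move=> bf; apply: (@bessel_inequality _ _ _ mu D _ _ (fun j x => cos (j.+1%:R * pi * x))) => //.
- exact: lebesgue_measure01_lty.
- by move=> j; apply: continuousT_bounded_measurable; exact: continuous_cosM.
- exact: Rintegral_cos_cos.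
Qed.

Lemma bessel_sin (f : R -> R) n : bounded_measurable D f ->
  \sum_(0 <= j < n) (Rintegral mu D (fun x => f x * sin (j.+1%:R * pi * x))) ^+ 2 <=
  2^-1 * Rintegral mu D (fun x => f x ^+ 2).
Proof.
move=> bf; apply: (@bessel_inequality _ _ _ mu D _ _ (fun j x => sin (j.+1%:R * pi * x))) => //.
- exact: lebesgue_measure01_lty.
- by move=> j; apply: continuousT_bounded_measurable; exact: continuous_sinM.
- exact: Rintegral_sin_sin.
Qed.

End unit_interval.

(** * The kernel paired with a test function *)

Section heat_kernel.
Context {R : realType}.
Notation mu := (@lebesgue_measure R).
Notation D := (`[0%R, 1%R]%classic : set R).
Variables (a b : R).
Hypothesis a0 : 0 < a.

Let kappa := a * pi ^+ 2.

Let kappa_gt0 : 0 < kappa.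
Proof. by rewrite mulr_gt0// exprn_gt0// pi_gt0. Qed.

(** Here [s] stands for the square root of a time. The geometric series of ratio [decay s] has a sum
    of order [1 / s] for small [s], which is the order [u^(-1/2)] of the heat kernel on the
    diagonal. *)
Let decay (s : R) := expR (- (2 * kappa * s)).

Lemma decay_itv s : 0 < s -> 0 <= decay s < 1.
Proof.
move=> s0; rewrite /decay expR_ge0/= expRN invf_lt1 ?expR_gt0// expR_gt1.
by apply: mulr_gt0 => //; exact: mulr_gt0.
Qed.

(* The Gaussian factor is dominated by a geometric one because [j^2 s^2 >= 2 j s - 1]. *)
Lemma expR_sigmaj_le s u j : 0 <= s -> s ^+ 2 <= u ->
  expR (- (sigmaj a b j * u)) <= expR kappa * decay s ^+ j.
Proof.
move=> s0 su.
have u0 : 0 <= u by apply: le_trans su; exact: sqr_ge0.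
rewrite /decay -expRM_natl -expRD ler_expR.
rewrite lerNl opprD mulrN opprK.
suff h : j%:R * (2 * kappa * s) - kappa <= sigmaj a b j * u by rewrite addrC.
apply: (@le_trans _ _ (kappa * (j%:R * s) ^+ 2)).
  rewrite -subr_ge0 (_ : _ - _ = kappa * (j%:R * s - 1) ^+ 2); last by ring.
  by apply: mulr_ge0; [exact: ltW|exact: sqr_ge0].
rewrite /sigmaj; have [->|_] := eqVneq j 0%N; first by rewrite mul0r expr0n/= mulr0 mul0r.
apply: (@le_trans _ _ (a * (j%:R * pi) ^+ 2 * u)).
  rewrite (_ : kappa * _ = a * (j%:R * pi) ^+ 2 * s ^+ 2); last by rewrite /kappa; ring.
  by rewrite ler_wpM2l// mulr_ge0 ?sqr_ge0// ltW.
apply: ler_wpM2r => //; apply: ler_wpM2l; first exact: ltW.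
by rewrite lerDr sqr_ge0.
Qed.

(** From [e^y >= 1 + y] one gets [1 - e^-y >= y / (1 + y)], here with [y = 2 * kappa * s]. *)
Lemma inv_1Bdecay_le s : 0 < s -> (1 - decay s)^-1 <= 1 + (2 * kappa * s)^-1.
Proof.
move=> s0; set y := 2 * kappa * s.
have y0 : 0 < y by apply: mulr_gt0 => //; exact: mulr_gt0.
have dy : decay s <= (1 + y)^-1.
  rewrite /decay -/y expRN lef_pV2 ?posrE ?expR_gt0 ?expR_ge1Dx//.
  by rewrite addr_gt0.
have h : y / (1 + y) <= 1 - decay s.
  rewrite (_ : y / (1 + y) = 1 - (1 + y)^-1); first by rewrite lerB.
  by field; rewrite gt_eqF// addr_gt0.
have yy : 0 < y / (1 + y) by rewrite divr_gt0// addr_gt0.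
rewrite (@le_trans _ _ (y / (1 + y))^-1)//.
  by rewrite lef_pV2 ?posrE// (lt_le_trans yy).
rewrite (_ : (y / (1 + y))^-1 = 1 + y^-1)//.
by field; rewrite !gt_eqF// addr_gt0.
Qed.

(** The mode of index [0] is constant, so its value at [0] bounds it; the second summand bounds all
    other modes on [[0, 1]]. *)
Definition psi_bound : R := `|psi a b 0 0| + Num.sqrt 2 * expR `|cc a b|.

Lemma psi_bound_ge0 : 0 <= psi_bound.
Proof. by rewrite addr_ge0// mulr_ge0 ?sqrtr_ge0 ?expR_ge0. Qed.

Lemma psi_le j x : D x -> `|psi a b j x| <= psi_bound.
Proof.
rewrite /= in_itv/= => /andP[x0 x1].
rewrite /psi_bound; have [->|j0] := eqVneq j 0%N.
  rewrite (_ : psi a b 0 x = psi a b 0 0); last by rewrite /psi eqxx.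
  by rewrite lerDl mulr_ge0 ?sqrtr_ge0 ?expR_ge0.
rewrite ler_wpDl// {1}/psi (negbTE j0); move: (cc a b) (kj a b j) => k th.
rewrite !normrM.
rewrite (ger0_norm (sqrtr_ge0 _)) (ger0_norm (expR_ge0 _)).
rewrite -[leRHS]mulr1 ler_pM ?mulr_ge0 ?sqrtr_ge0 ?expR_ge0 ?sin_max//.
rewrite ler_wpM2l ?sqrtr_ge0// ler_expR.
rewrite (le_trans (ler_norm _))// normrM (ger0_norm x0).
by rewrite ler_piMr.
Qed.

Lemma continuous_psi j : continuous (psi a b j).
Proof.
rewrite /psi; case: eqP => [_|_]; first by move=> x; exact: cvg_cst.
move=> x; apply: cvgM.
  apply: cvgM; first exact: cvg_cst.
  apply: (@continuous_comp _ _ _ (fun x => cc a b * x) expR); last exact: continuous_expR.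
  by apply: cvgM; [exact: cvg_cst|exact: cvg_id].
apply: (@continuous_comp _ _ _ (fun x => j%:R * pi * x + kj a b j) sin); last exact: continuous_sin.
apply: cvgD; last exact: cvg_cst.
by apply: cvgM; [exact: cvg_cst|exact: cvg_id].
Qed.

Lemma measurable_psi E j : measurable_fun E (psi a b j).
Proof.
apply: measurable_funTS; apply: continuous_measurable_fun.
exact: continuous_psi.
Qed.

Section term_bounds.
Variables (s u : R).
Hypotheses (s0 : 0 < s) (su : s ^+ 2 <= u).

Lemma expR_sigmaj_psi_le j x : D x ->
  `|expR (- (sigmaj a b j * u)) * psi a b j x| <= (expR kappa * psi_bound) * decay s ^+ j.
Proof.
move=> Dx; rewrite normrM (ger0_norm (expR_ge0 _)) mulrAC.
by rewrite ler_pM ?expR_ge0// ?psi_le// expR_sigmaj_le// ltW.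
Qed.

Lemma Pker_term_le j y x : D y -> D x ->
  `|expR (- (sigmaj a b j * u)) * psi a b j y * psi a b j x| <=
  (expR kappa * psi_bound * psi_bound) * decay s ^+ j.
Proof.
move=> Dy Dx; rewrite normrM [leRHS]mulrAC.
by rewrite ler_pM ?psi_le// expR_sigmaj_psi_le.
Qed.

Lemma bounded_measurable_Pker y : D y -> bounded_measurable D (Pker a b u y).
Proof.
move=> Dy; change (bounded_measurable D (fun x : R => limn (series (fun j : nat =>
  expR (- (sigmaj a b j * u)) * psi a b j y * psi a b j x)))).
apply: (@bounded_measurable_limn_series _ _ _ D
  (fun j x => expR (- (sigmaj a b j * u)) * psi a b j y * psi a b j x)
  (expR kappa * psi_bound * psi_bound) _ (decay_itv s0)) => //.
- by move=> j; apply: measurable_funM => //; exact: measurable_psi.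
- by move=> x Dx j; exact: Pker_term_le.
Qed.

(** Integrating the series termwise against [nu] leaves a series of multiples of the [psi_j] in [x],
    which settles measurability in [x] without any joint measurability of the kernel. *)
Lemma bounded_measurable_Pker_integral (nu : {finite_measure set R -> \bar R}) :
  bounded_measurable D (fun x => fine (\int[nu]_(y in `[0, 1]) (Pker a b u y x)%:E)).
Proof.
have nufin : (nu D < +oo)%E by rewrite -ge0_fin_numE// fin_num_measure.
pose I j := Rintegral nu D (psi a b j).
have bpsi j : bounded_measurable D (psi a b j).
  by apply: continuousT_bounded_measurable; exact: continuous_psi.
pose h x := limn (series (fun j => expR (- (sigmaj a b j * u)) * psi a b j x * I j)).
have hE x : D x -> fine (\int[nu]_(y in D) (Pker a b u y x)%:E) = h x.
  move=> Dx; transitivity (Rintegral nu D (fun y => Pker a b u y x)) => //.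
  rewrite (@Rintegral_series _ _ _ nu D _ nufin
    (fun j y => expR (- (sigmaj a b j * u)) * psi a b j y * psi a b j x)
    (expR kappa * psi_bound * psi_bound) _ (decay_itv s0))//.
  - congr (limn (series _)); apply/funext => j.
    rewrite /I -RintegralZl//; last first.
      exact (@bounded_measurable_integrable _ _ _ nu D (measurable_itv _) nufin _ (bpsi j)).
    by apply: eq_Rintegral => y _; rewrite mulrAC.
  - move=> j; apply: measurable_funM => //; apply: measurable_funM => //.
    exact: measurable_psi.
  - by move=> y Dy j; exact: Pker_term_le.
have [mh [C hC]] : bounded_measurable D h.
  apply: (@bounded_measurable_limn_series _ _ _ D
    (fun j x => expR (- (sigmaj a b j * u)) * psi a b j x * I j)
    (expR kappa * psi_bound * (psi_bound * fine (nu D))) _ (decay_itv s0)) => //.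
  - move=> j; apply: measurable_funM => //; apply: measurable_funM => //.
    exact: measurable_psi.
  - move=> x Dx j; rewrite normrM [leRHS]mulrAC ler_pM// ?expR_sigmaj_psi_le//.
    apply: normr_Rintegral_le => //; first exact: measurable_psi.
    by move=> y; exact: psi_le.
split; last by exists C => x Dx; rewrite hE// hC.
by apply: eq_measurable_fun mh => x; rewrite inE => Dx; rewrite hE.
Qed.

End term_bounds.

(** * The kernel integrated against a bounded test function *)

Section pairing.
Variables (alpha : R) (phi : R -> R).
Hypotheses (alpha0 : 0 < alpha) (bphi : bounded_measurable D phi).

Definition psi_coeff j : R := Rintegral mu D (fun x => psi a b j x * phi x).

(** The factor [e^(c x)] is absorbed into the test function and the phase [k_j] is expanded by the
    addition formula. Each coefficient then combines a sine and a cosine coefficient of the same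
    function [f], and Bessel's inequality applies to both systems. *)
Lemma sum_psi_coeff_bounded :
  exists2 K : R, 0 <= K & forall n, \sum_(0 <= j < n) psi_coeff j ^+ 2 <= K.
Proof.
pose f x := expR (cc a b * x) * phi x.
have bE : bounded_measurable D (fun x => expR (cc a b * x)).
  apply: continuousT_bounded_measurable => x.
  apply: (@continuous_comp _ _ _ (fun x => cc a b * x) expR); last exact: continuous_expR.
  by apply: cvgM; [exact: cvg_cst|exact: cvg_id].
have bf : bounded_measurable D f by exact: bounded_measurableM.
pose S j := Rintegral mu D (fun x => f x * sin (j.+1%:R * pi * x)).
pose C j := Rintegral mu D (fun x => f x * cos (j.+1%:R * pi * x)).
have coefE j : psi_coeff j.+1 = Num.sqrt 2 * (cos (kj a b j.+1) * S j + sin (kj a b j.+1) * C j).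
  have bS : bounded_measurable D (fun x => f x * sin (j.+1%:R * pi * x)).
    by apply: bounded_measurableM => //; apply: continuousT_bounded_measurable; exact: continuous_sinM.
  have bC : bounded_measurable D (fun x => f x * cos (j.+1%:R * pi * x)).
    by apply: bounded_measurableM => //; apply: continuousT_bounded_measurable; exact: continuous_cosM.
  have fin := @lebesgue_measure01_lty R.
  rewrite /S /C -!RintegralZl//; [|exact: bounded_measurable_integrable..].
  rewrite -RintegralD//; [|apply: bounded_measurable_integrable => //; exact: bounded_measurableZ..].
  rewrite -RintegralZl//; last first.
    by apply: bounded_measurable_integrable => //; apply: bounded_measurableD; exact: bounded_measurableZ.
  have psiE (x : R) : psi a b j.+1 x * phi x = Num.sqrt 2 *
      (cos (kj a b j.+1) * (f x * sin (j.+1%:R * pi * x)) +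
       sin (kj a b j.+1) * (f x * cos (j.+1%:R * pi * x))).
    by rewrite /psi /f sinD /=; ring.
  by apply: eq_Rintegral => x _; exact: psiE.
have coef2 j : psi_coeff j.+1 ^+ 2 <= 2 * (S j ^+ 2 + C j ^+ 2).
  rewrite coefE exprMn sqr_sqrtr// ler_wpM2l//.
  set k := kj a b j.+1; rewrite -subr_ge0.
  (* Lagrange's identity, with [cos k] and [sin k] as a unit vector. *)
  rewrite (_ : _ - _ = (sin k * S j - cos k * C j) ^+ 2 +
    (S j ^+ 2 + C j ^+ 2) * (1 - (cos k ^+ 2 + sin k ^+ 2))); last by ring.
  by rewrite cos2Dsin2 subrr mulr0 addr0 sqr_ge0.
pose I := Rintegral mu D (fun x => f x ^+ 2).
have I0 : 0 <= I by apply: Rintegral_ge0 => x _; exact: sqr_ge0.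
exists (psi_coeff 0 ^+ 2 + 2 * I); first by rewrite addr_ge0 ?sqr_ge0 ?mulr_ge0.
case=> [|n]; first by rewrite big_geq// addr_ge0 ?sqr_ge0 ?mulr_ge0.
rewrite big_nat_recl// lerD2l (le_trans (ler_sum _ (fun j _ => coef2 j)))//.
rewrite -mulr_sumr ler_wpM2l// big_split/=.
have := lerD (bessel_sin n bf) (bessel_cos n bf).
by rewrite -mulrDl (_ : 2^-1 + 2^-1 = 1) ?mul1r//; field.
Qed.

(** The function [G] extended by [0] to [u <= 0], so that a jump later than the observation time
    contributes nothing. The value at [u = 0] is a convention; arrivals at exactly that time are
    excluded almost surely. *)
Definition kernel_pairing (beta u : R) : R :=
  if 0 < u then expR (- (alpha * u)) *
    limn (series (fun j => expR (- (sigmaj a b j * u)) * psi a b j beta * psi_coeff j))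
  else 0.

Lemma psi_coeff_le : exists2 C : R, 0 <= C & forall j, `|psi_coeff j| <= C.
Proof.
have [mphi [A phiA]] := bphi.
exists (psi_bound * `|A|); first by rewrite mulr_ge0// psi_bound_ge0.
move=> j; rewrite -[leRHS]mulr1 -[X in _ * X]/(fine 1%E) -lebesgue_measure01.
apply: normr_Rintegral_le => //; first exact: lebesgue_measure01_lty.
  by apply: measurable_funM => //; exact: measurable_psi.
move=> x Dx; rewrite normrM ler_pM// ?psi_le// (le_trans (phiA _ Dx))//.
exact: ler_norm.
Qed.

Lemma sqrtr_sqr_le (u : R) : 0 < u -> 0 < Num.sqrt u /\ Num.sqrt u ^+ 2 <= u.
Proof. by move=> u0; rewrite sqrtr_gt0 sqr_sqrtr// ltW. Qed.

Lemma kernel_pairing_series_le s C u beta : 0 < s -> s ^+ 2 <= u -> D beta ->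
  (forall j, `|psi_coeff j| <= C) -> forall j,
  `|expR (- (sigmaj a b j * u)) * psi a b j beta * psi_coeff j| <=
    expR kappa * psi_bound * C * decay s ^+ j.
Proof.
move=> s0 su Db hC j; rewrite normrM [leRHS]mulrAC ler_pM//.
exact: expR_sigmaj_psi_le.
Qed.

Lemma Rintegral_PkerM u beta : 0 < u -> D beta ->
  Rintegral mu D (fun x => expR (- (alpha * u)) * Pker a b u beta x * phi x) =
  kernel_pairing beta u.
Proof.
move=> u0 Db; rewrite /kernel_pairing u0.
have [s0 su] := sqrtr_sqr_le u0.
have fin := @lebesgue_measure01_lty R.
have bPphi : bounded_measurable D (fun x => Pker a b u beta x * phi x).
  by apply: bounded_measurableM => //; exact: bounded_measurable_Pker s0 su _ Db.
under eq_Rintegral do rewrite -mulrA.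
rewrite RintegralZl//; last exact: bounded_measurable_integrable.
congr (_ * _).
have [mphi [A phiA]] := bphi.
have cv x : D x -> cvgn (series (fun j => expR (- (sigmaj a b j * u)) * psi a b j beta * psi a b j x)).
  move=> Dx; apply: (geometric_dominated_cvg (decay_itv s0)) => j.
  exact: Pker_term_le.
transitivity (Rintegral mu D (fun x => limn (series (fun j =>
    expR (- (sigmaj a b j * u)) * psi a b j beta * psi a b j x * phi x)))).
  apply: eq_Rintegral => x; rewrite inE => Dx; rewrite /Pker.
  apply/esym/cvg_lim => //.
  rewrite (_ : series _ = (fun n => series (fun j =>
    expR (- (sigmaj a b j * u)) * psi a b j beta * psi a b j x) n * phi x)); last first.
    by apply/funext => n; rewrite /series/= mulr_suml.
  by apply: cvgM; [exact: cv|exact: cvg_cst].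
rewrite (@Rintegral_series _ _ _ mu D _ fin
  (fun j x => expR (- (sigmaj a b j * u)) * psi a b j beta * psi a b j x * phi x)
  (expR kappa * psi_bound * psi_bound * `|A|) _ (decay_itv s0))//.
- congr (limn (series _)); apply/funext => j.
  rewrite /psi_coeff -RintegralZl//; last first.
    apply: bounded_measurable_integrable => //; apply: bounded_measurableM => //.
    by apply: continuousT_bounded_measurable; exact: continuous_psi.
  by apply: eq_Rintegral => x _; rewrite mulrA.
- move=> j; apply: measurable_funM => //; apply: measurable_funM => //.
  exact: measurable_psi.
- move=> x Dx j; rewrite normrM [leRHS]mulrAC ler_pM// ?Pker_term_le//.
  by rewrite (le_trans (phiA _ Dx))// ler_norm.
Qed.

(** The bound [G^2 <= C u^(-1/2)], stated at the scales [u >= 16^-m]. Cauchy-Schwarz separates the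
    square summable coefficients from the exponentials, whose squares are summed geometrically with
    [s = 4^-m]. *)
Lemma kernel_pairing_sqr_le : exists2 C : R, 0 <= C & forall m u beta, D beta ->
  ((4 ^+ m)^-1) ^+ 2 <= u -> kernel_pairing beta u ^+ 2 <= C * 4 ^+ m.
Proof.
have [K K0 hK] := sum_psi_coeff_bounded.
have [B B0 hB] := psi_coeff_le.
pose C1 := (expR kappa * psi_bound) ^+ 2 * (1 + (2 * kappa)^-1).
have C10 : 0 <= C1.
  by rewrite mulr_ge0 ?sqr_ge0// addr_ge0// invr_ge0 mulr_ge0// ltW.
exists (C1 * K) => [|m u beta Db su]; first by rewrite mulr_ge0.
have s0 : 0 < (4 ^+ m)^-1 :> R by rewrite invr_gt0 exprn_gt0.
have u0 : 0 < u by apply: lt_le_trans su; rewrite exprn_gt0.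
rewrite /kernel_pairing u0.
set u_ := fun j => _ * psi_coeff j.
have cv : cvgn (series u_).
  exact: geometric_dominated_cvg (decay_itv s0) (kernel_pairing_series_le s0 su Db hB).
rewrite exprMn (@le_trans _ _ (limn (series u_) ^+ 2))//.
  rewrite ler_piMl ?sqr_ge0// expr_le1 ?expR_ge0// -expR0 ler_expR oppr_le0.
  by rewrite mulr_ge0// ltW.
have cv2 : series u_ n ^+ 2 @[n --> \oo] --> limn (series u_) ^+ 2.
  by rewrite [X in _ --> X]expr2; under eq_fun do rewrite expr2; exact: cvgM.
rewrite -(cvg_lim _ cv2)//.
apply: limr_le; first by apply: cvgP cv2.
apply: nearW => n; rewrite /series/=.
rewrite (le_trans (sqr_sum_mul_le (fun j => expR (- (sigmaj a b j * u)) * psi a b j beta) psi_coeff n))//.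
rewrite mulrAC ler_pM ?sumr_ge0// => [j _|j _|]; [exact: sqr_ge0|exact: sqr_ge0|].
have [z0 z1] := andP (decay_itv s0).
apply: (@le_trans _ _ (\sum_(0 <= j < n) (expR kappa * psi_bound) ^+ 2 * decay (4 ^+ m)^-1 ^+ j)).
  apply: ler_sum => j _; rewrite -[leLHS]real_normK ?num_real//.
  apply: (@le_trans _ _ (((expR kappa * psi_bound) * decay (4 ^+ m)^-1 ^+ j) ^+ 2)).
    by rewrite ler_sqr ?nnegrE ?mulr_ge0 ?expR_ge0 ?psi_bound_ge0 ?exprn_ge0// expR_sigmaj_psi_le.
  (* One of the two factors [decay ^+ j] is dropped, so that the ratio stays [decay s]. *)
  rewrite exprMn ler_wpM2l ?sqr_ge0// expr2 ler_piMr ?exprn_ge0//.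
  by rewrite exprn_ile1// ltW.
rewrite (le_trans (series_geometric_le n _ (decay_itv s0)))// ?sqr_ge0//.
rewrite /C1 -[leRHS]mulrA; apply: ler_wpM2l; first exact: sqr_ge0.
rewrite (le_trans (inv_1Bdecay_le s0))//.
(* At [s = 4^-m] the bound [1 + 1 / (2 kappa s)] is at most [4^m (1 + 1 / (2 kappa))], whence
   [C1]. *)
rewrite [leRHS]mulrDl mul1r; apply: lerD; first by rewrite exprn_ege1// ler1n.
by rewrite invfM invrK.
Qed.

Lemma kernel_pairing_cvg (beta u : nat -> R) beta0 u0 :
  (forall n, D (beta n)) -> u0 != 0 ->
  beta n @[n --> \oo] --> beta0 -> u n @[n --> \oo] --> u0 ->
  kernel_pairing (beta n) (u n) @[n --> \oo] --> kernel_pairing beta0 u0.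
Proof.
move=> Db un0 cb cu.
have [B B0 hB] := psi_coeff_le.
have [u0gt|] := ltrP 0 u0; last first.
  rewrite le_eqVlt (negbTE un0)/= => u0lt.
  rewrite /kernel_pairing (lt_gtF u0lt).
  apply: cvg_near_cst; near=> n.
  suff -> : (0 < u n) = false by [].
  apply/negbTE; rewrite -leNgt ltW//; near: n.
  exact: (cvgr_lt u0).
rewrite {2}/kernel_pairing u0gt.
(* Eventually [u n >= u0 / 2], so the geometric majorant with [s = sqrt (u0 / 2)] dominates all
   these series at once. *)
have h0 : 0 < u0 / 2 by rewrite divr_gt0.
have [s0 su] := sqrtr_sqr_le h0.
have un : \forall n \near \oo, u0 / 2 <= u n.
  apply: (cvgr_ge u0) => //.
  by rewrite ltr_pdivrMr// ltr_pMr// ltr1n.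
have expRcvg (c : R) : expR (- (c * u n)) @[n --> \oo] --> expR (- (c * u0)).
  apply: continuous_cvg; first exact: continuous_expR.
  by apply: cvgN; apply: cvgM => //; exact: cvg_cst.
have lims : limn (series (fun j => expR (- (sigmaj a b j * u n)) * psi a b j (beta n) * psi_coeff j))
    @[n --> \oo] -->
    limn (series (fun j => expR (- (sigmaj a b j * u0)) * psi a b j beta0 * psi_coeff j)).
  apply: (@geometric_dominated_cvg_lim _ (fun n j =>
    expR (- (sigmaj a b j * u n)) * psi a b j (beta n) * psi_coeff j) _ _ _ (decay_itv s0)).
    near=> n; apply: kernel_pairing_series_le => //.
    by rewrite (le_trans su)//; near: n.
  move=> j; apply: cvgM; last exact: cvg_cst.
  apply: cvgM; first exact: expRcvg.
  by apply: continuous_cvg => //; exact: continuous_psi.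
apply: cvg_trans (cvgM (expRcvg alpha) lims); apply: near_eq_cvg.
near=> n; rewrite /kernel_pairing.
suff -> : 0 < u n by [].
by rewrite (lt_le_trans h0)//; near: n.
Unshelve. all: by end_near. Qed.

Lemma measurable_kernel_pairing d (T : measurableType d) (beta u : T -> R) :
  (forall w, D (beta w)) ->
  measurable_fun [set: T] beta -> measurable_fun [set: T] u ->
  measurable_fun [set: T] (fun w => kernel_pairing (beta w) (u w)).
Proof.
move=> Db mb mU.
have [B B0 hB] := psi_coeff_le.
apply: (@measurable_fun_cvg _ _ _ _ (fun n w => if 0 < u w then expR (- (alpha * u w)) *
    series (fun j => expR (- (sigmaj a b j * u w)) * psi a b j (beta w) * psi_coeff j) n
  else 0)) => // [n|w _]; last first.
  rewrite /kernel_pairing; case: ifPn => uw; last exact: cvg_cst.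
  apply: cvgM; first exact: cvg_cst.
  have [s0 su] := sqrtr_sqr_le uw.
  exact: geometric_dominated_cvg (decay_itv s0) (kernel_pairing_series_le s0 su (Db w) hB).
have mexp (c : R) : measurable_fun [set: T] (fun w => expR (- (c * u w))).
  apply: (@measurableT_comp _ _ _ _ _ _ expR) => //.
  by under eq_fun do rewrite -mulNr; exact: measurable_funM.
apply: measurable_fun_ifT => //; first exact: measurable_fun_ltr.
apply: measurable_funM => //; apply: measurable_sum => j.
apply: measurable_funM => //; apply: measurable_funM => //.
by apply: measurableT_comp mb; exact: measurable_psi.
Qed.

End pairing.
End heat_kernel.

(** * Arrival times of the Poisson process *)

Lemma In_mem (s : seq nat) i : List.In i s <-> i \in s.
Proof.
elim: s => [//|j s IH] /=; rewrite in_cons; split.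
  by move=> [->|/IH ->]; rewrite ?eqxx// orbT.
by move=> /orP[/eqP ->|/IH ?]; [left|right].
Qed.

Lemma NoDup_uniq (s : seq nat) : uniq s -> List.NoDup s.
Proof.
elim: s => [_|j s IH /= /andP[js us]]; first exact: List.NoDup_nil.
by apply: List.NoDup_cons; [rewrite In_mem; exact/negP|exact: IH].
Qed.

Section exponential_law.
Context {R : realType}.
Implicit Types (x y : R).

Lemma exponential_pdf1_le1 x : exponential_pdf 1 x <= 1 :> R.
Proof.
have [x0|x0] := ltP x 0; first by rewrite lt0_exponential_pdf.
by rewrite exponential_pdfE// mul1r mulN1r -expR0 ler_expR oppr_le0.
Qed.

Lemma exponential_prob_itv_le x y : x <= y -> (exponential_prob 1 `[x, y] <= (y - x)%:E)%E.
Proof.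
move=> xy; rewrite /exponential_prob.
apply: (@le_trans _ _ (\int[lebesgue_measure]_(z in `[x, y]) 1)%E); last first.
  by rewrite integral_cst//= mul1e lebesgue_measure_itv/= lte_fin; case: ltP => //; rewrite lee_fin subr_ge0.
apply: ge0_le_integral => //.
- by move=> z _; rewrite lee_fin exponential_pdf_ge0.
- by apply/measurable_EFinP; apply: measurable_funTS; exact: measurable_exponential_pdf.
- by move=> z _; rewrite lee_fin exponential_pdf1_le1.
Qed.

Lemma exponential_prob_lt0 : exponential_prob (1 : R) `]-oo, 0[ = 0%E.
Proof.
rewrite /exponential_prob integral0_eq// => x; rewrite /= in_itv/= => x0.
by rewrite lt0_exponential_pdf.
Qed.

End exponential_law.

Section poisson_arrivals.
Context d (T : measurableType d) (R : realType) (P : probability T R).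
Variable E : nat -> T -> R.
Hypothesis hE : std_poisson_interarrivals P E.

Let mE k : measurable_fun [set: T] (E k). Proof. by case: hE. Qed.
Let indE : mutually_independent P E. Proof. by case: hE => _ []. Qed.
Let expE k B : measurable B -> P (E k @^-1` B) = exponential_prob 1 B.
Proof. by case: hE => _ [_]; exact. Qed.

Let cyl (s : seq nat) (B : nat -> set R) : set T :=
  \bigcap_(i in [set i | List.In i s]) (E i @^-1` B i).

Lemma measurable_cylinder s B : (forall i, measurable (B i)) -> measurable (cyl s B).
Proof.
move=> mB; apply: bigcap_measurableType => i _.
by rewrite -[X in measurable X]setTI; exact: mE.
Qed.

Lemma cylinder_cons i s B : cyl (i :: s) B = E i @^-1` B i `&` cyl s B.
Proof.
apply/seteqP; split => w /=.
  by move=> h; split=> [|j js]; apply: h => /=; [left|right].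
by move=> [h1 h2] j /= [<-//|js]; exact: h2.
Qed.

Definition independent_of (lam : T -> R) := forall s B C,
  (forall i, measurable (B i)) -> measurable C ->
  P (cyl s B `&` lam @^-1` C) = (P (cyl s B) * P (lam @^-1` C))%E.

(** This lets the true parameter [lambda0] be handled by the same estimates as the estimators. *)
Lemma independent_of_cst c : independent_of (fun=> c).
Proof.
move=> s B C mB mC; have [Cc|Cc] := pselect (C c).
  rewrite (_ : _ @^-1` C = setT); last by apply/seteqP; split.
  by rewrite setIT probability_setT mule1.
rewrite (_ : _ @^-1` C = set0); last by apply/seteqP; split.
by rewrite setI0 !measure0 mule0.
Qed.

Lemma independent_families_independent_of (J : Type) (Y : J -> T -> R) j :
  independent_families P E Y -> independent_of (Y j).
Proof.
move=> EY s B C mB mC; have := EY s [:: j] B (fun=> C) mB (fun=> mC).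
rewrite (_ : \bigcap_(i in [set i | List.In i [:: j]]) (Y i @^-1` C) = Y j @^-1` C)//.
apply/seteqP; split => w /=; first by apply; left.
by move=> h i [<-|].
Qed.

(** * Independence of the first inter-arrival time from the later ones and [lam] *)

Section first_arrival.
Variables (lam : T -> R) (k : nat).
Hypotheses (mlam : measurable_fun [set: T] lam) (indlam : independent_of lam).

(** A pi-system for the sigma-algebra of [E 1, ..., E k] and [lam]; independence of [E 0] is checked
    on it and extended by Dynkin induction. *)
Let G : set (set T) := [set A | exists B C, [/\ forall i, measurable (B i), measurable C &
  A = cyl (iota 1 k) B `&` lam @^-1` C]].

Let setI_closed_G : setI_closed G.
Proof.
move=> _ _ [B [C [mB mC ->]]] [B' [C' [mB' mC' ->]]].
exists (fun i => B i `&` B' i), (C `&` C'); split.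
- by move=> i; exact: measurableI.
- exact: measurableI.
- apply/seteqP; split => w /=.
    by move=> [[h1 h2] [h3 h4]]; split=> // i /= ii; split; [exact: h1|exact: h3].
  by move=> [h1 [h2 h3]]; split; split=> // i ii; have [] := h1 i ii.
Qed.

Let measurable_G A : G A -> measurable A.
Proof.
move=> [B [C [mB mC ->]]]; apply: measurableI; first exact: measurable_cylinder.
by rewrite -[X in measurable X]setTI; exact: mlam.
Qed.

Let indep0 (A : set T) := measurable A /\ forall B, measurable B ->
  P (E 0%N @^-1` B `&` A) = (P (E 0%N @^-1` B) * P A)%E.

Let mE0 B : measurable B -> measurable (E 0%N @^-1` B).
Proof. by move=> mB; rewrite -[X in measurable X]setTI; exact: mE. Qed.

Let indep0_G A : G A -> indep0 A.
Proof.
move=> GA; split; first exact: measurable_G.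
case: GA => B [C [mB mC ->]] D mD.
(* [D] is placed in the slot [0], which [iota 1 k] does not see, so that a single family of sets
   describes both factors. *)
pose B' i := if i is 0%N then D else B i.
have mB' i : measurable (B' i) by case: i => [|i]; [exact: mD|exact: mB].
have cE : cyl (iota 1 k) B' = cyl (iota 1 k) B.
  by apply: eq_bigcapr => -[|i]//= /In_mem; rewrite mem_iota.
have := indlam (0%N :: iota 1 k) mB' mC.
rewrite cylinder_cons/= cE -setIA => ->.
rewrite indlam// muleA; congr (_ * _)%E.
rewrite -cE -(cylinder_cons 0 (iota 1 k) B').
have u0 : uniq (0%N :: iota 1 k) by exact: (iota_uniq 0 k.+1).
have u1 : uniq (iota 1 k) by exact: iota_uniq.
by rewrite (indE (NoDup_uniq u0) mB') (indE (NoDup_uniq u1) mB') big_cons.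
Qed.

Let indep0_sigma A : <<s G >> A -> indep0 A.
Proof.
move: A; apply: (@dynkin_induction _ (g_sigma_algebraType G) G indep0) => //.
- by split=> // B mB; rewrite setIT probability_setT mule1.
- move=> S _ [mS iS]; split; first exact: measurableC.
  move=> B mB; have mEB := mE0 mB.
  have fB : P (E 0%N @^-1` B) \is a fin_num by exact: fin_num_measure.
  rewrite probability_setC// muleBr//.
  by rewrite mule1 -iS// -setDE measureD//= ltey_eq fB.
- move=> F _ tF iF'.
  have mF n : measurable (F n : set T) := (iF' n).1.
  have iF n := (iF' n).2.
  split; first exact: bigcup_measurable.
  move=> B mB; rewrite setI_bigcupr.
  rewrite measure_bigcup//; last 2 first.
  + by move=> n _; apply: measurableI => //; exact: mE0.
  + exact: trivIset_setIl.
  have fB : P (E 0%N @^-1` B) \is a fin_num by exact/fin_num_measure/mE0.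
  rewrite measure_bigcup//= -(fineK fB) -nneseriesZl//.
  by apply: eq_eseriesr => n _; rewrite iF// fineK.
Qed.

Let mEG i : (0 < i <= k)%N -> measurable_fun [set: g_sigma_algebraType G] (E i).
Proof.
move=> ik _ B mB; rewrite setTI; apply: sub_sigma_algebra.
exists (fun j => if j == i then B else setT), setT; split => //.
  by move=> j; case: ifP.
rewrite preimage_setT setIT; apply/seteqP; split => w /=.
  by move=> h j _ /=; case: eqP => [->|].
by move=> /(_ i)/=; rewrite eqxx; apply; apply/In_mem; rewrite mem_iota add1n ltnS.
Qed.

Let mlamG : measurable_fun [set: g_sigma_algebraType G] lam.
Proof.
move=> _ B mB; rewrite setTI; apply: sub_sigma_algebra.
exists (fun=> setT), B; split => //.
by rewrite (_ : cyl _ _ = setT) ?setTI//; apply/seteqP; split.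
Qed.

Variables (L t h : R).
Hypothesis h0 : 0 < h.

Let W := cyl (iota 1 k) (fun=> `[0, L]%classic).
(** Chosen so that [Z w - E 0 w] is [lam w * t - arrival E k w]. *)
Let Z w := lam w * t - \sum_(1 <= i < k.+1) E i w.

Let mZG : measurable_fun [set: g_sigma_algebraType G] Z.
Proof.
apply: measurable_funB; first by apply: measurable_funM => //; exact: measurable_cst.
rewrite /index_iota subSS subn0.
have hh : forall s, all (fun i => 0 < i <= k)%N s ->
    measurable_fun [set: g_sigma_algebraType G] (fun w => \sum_(i <- s) E i w).
  elim=> [_|i s IH /= /andP[ik sk]].
    by under eq_fun do rewrite big_nil; exact: measurable_cst.
  under eq_fun do rewrite big_cons; apply: measurable_funD; first exact: mEG.
  exact: IH.
by apply: hh; apply/allP => i; rewrite mem_iota add1n ltnS.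
Qed.

Let WG : <<s G >> W.
Proof.
apply: sub_sigma_algebra; exists (fun=> `[0, L]%classic), setT; split => //.
by rewrite preimage_setT setIT.
Qed.

Let cell n := W `&` Z @^-1` `[n%:R * h, n.+1%:R * h[.

Let cell_indep n : indep0 (cell n).
Proof.
apply: indep0_sigma.
apply: (@measurableI _ (g_sigma_algebraType G)); first exact: WG.
by rewrite -[X in measurable X]setTI; exact: mZG.
Qed.

Let trivIset_cell : trivIset setT cell.
Proof.
apply/trivIsetP => i j _ _ ij; apply/seteqP; split=> // w [[_ zi] [_ zj]]; move: zi zj.
rewrite /= !in_itv/= => /andP[i1 i2] /andP[j1 j2].
have := le_lt_trans i1 j2; rewrite ltr_pM2r// ltr_nat ltnS => h1.
have := le_lt_trans j1 i2; rewrite ltr_pM2r// ltr_nat ltnS => h2.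
by move: ij; rewrite eqn_leq h1 h2.
Qed.

(* Conditionally on the later inter-arrival times, the first one must fall in an
   interval of length [h], which is seen by slicing the range of [Z] into cells of length [h]. *)
Lemma first_arrival_window_le :
  (P (W `&` [set w | ((0 <= E 0%N w) && (0 <= Z w - E 0%N w <= h))%R]) <=
   (2 * h)%:E * P W)%E.
Proof.
(* If [Z] lies in the [n]-th cell and [0 <= Z - E 0 <= h], then [E 0] lies in [B n], which has
   length [2 h]: the cell itself plus the tolerance [h]. Hence the factor [2]. *)
pose B n : set R := `[n%:R * h - h, n.+1%:R * h]%classic.
have mX n : measurable (E 0%N @^-1` B n `&` cell n).
  apply: measurableI; last by have [] := cell_indep n.
  by apply: mE0; exact: measurable_itv.
have mcell n : measurable (cell n) by have [] := cell_indep n.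
have mW : measurable W by apply: measurable_cylinder.
have mZ : measurable_fun [set: T] Z.
  apply: measurable_funB; first by apply: measurable_funM => //; exact: measurable_cst.
  by apply: measurable_sum.
apply: (@le_trans _ _ (\sum_(n <oo) P (E 0%N @^-1` B n `&` cell n))%E).
  apply: measure_sigma_subadditive => //.
    apply: measurableI => //.
    rewrite (_ : [set w | _] = E 0%N @^-1` `[0, +oo[ `&` (fun w => Z w - E 0%N w) @^-1` `[0, h]).
      apply: measurableI; first exact: mE0.
      rewrite -[X in measurable X]setTI.
      by apply: (measurable_funB mZ (mE 0)) => //.
    by apply/seteqP; split => w /=; rewrite !in_itv/= andbT; [move=> /andP|move=> [-> ->]].
  move=> w [Ww /= /andP[e0 /andP[z1 z2]]].
  have Z0 : 0 <= Z w by rewrite (le_trans e0)// -subr_ge0.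
  have zh : 0 <= Z w / h by rewrite divr_ge0// ltW.
  have /andP[n1 n2] := truncn_itv zh.
  rewrite ler_pdivlMr// in n1; rewrite ltr_pdivrMr// in n2.
  exists (Num.truncn (Z w / h)) => //; split; last by split=> //=; rewrite in_itv/= n1 n2.
  by rewrite /B /= in_itv/=; apply/andP; split; lra.
apply: (@le_trans _ _ (\sum_(n <oo) (2 * h)%:E * P (cell n))%E).
  apply: lee_nneseries => // n _.
  have [_ ->] := cell_indep n; last exact: measurable_itv.
  rewrite lee_wpmul2r// expE; last exact: measurable_itv.
  apply: le_trans (exponential_prob_itv_le _) _.
    by rewrite -natr1 mulrDl mul1r lerD2l (le_trans _ (ltW h0))// oppr_le0 ltW.
  by rewrite lee_fin (_ : _ - _ = 2 * h)// -natr1; ring.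
rewrite nneseriesZl//.
apply: lee_wpmul2l; first by rewrite lee_fin mulr_ge0// ltW.
have -> : (\sum_(n <oo) P (cell n))%E = P (\bigcup_n cell n).
  by rewrite measure_bigcup//=; apply: eq_eseriesl => n; rewrite in_setT.
apply: le_measure; rewrite ?inE//; first exact: bigcup_measurable.
by move=> w [n _ []].
Qed.

End first_arrival.

Variable L : R.
Hypothesis L0 : 0 < L.

Definition early_ratio : R := 1 - expR (- L).

Lemma early_ratio_itv : 0 <= early_ratio < 1.
Proof.
rewrite /early_ratio subr_ge0 gtrBl expR_gt0 andbT -expR0 ler_expR oppr_le0.
exact: ltW.
Qed.

(** For nonnegative inter-arrival times this contains the event [tau_k <= L]. Its probability is an
    exact power by independence, which takes the place of a Poisson tail estimate. *)
Definition early k : set T := [set w | forall i, (i <= k)%N -> 0 <= E i w <= L].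

Let cyl_prob s : uniq s -> P (cyl s (fun=> `[0, L]%classic)) = (early_ratio ^+ size s)%:E.
Proof.
move=> us; rewrite (indE (NoDup_uniq us))//.
elim: s {us} => [|i s IH]; first by rewrite big_nil.
rewrite big_cons {}IH expE// exponential_prob_itv0c// -EFinB -EFinM/= exprS.
by rewrite mulN1r.
Qed.

Lemma earlyE k : early k = cyl (iota 0 k.+1) (fun=> `[0, L]%classic).
Proof.
apply/seteqP; split => w h i.
  move=> hi; have := (In_mem (iota 0 k.+1) i).1 hi.
  by rewrite mem_iota add0n ltnS /= in_itv/= => /h.
move=> ik; have := h i; rewrite /= in_itv/=; apply.
by apply/(In_mem (iota 0 k.+1)); rewrite mem_iota add0n ltnS.
Qed.

Lemma measurable_early k : measurable (early k).
Proof. by rewrite earlyE; exact: measurable_cylinder. Qed.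

Lemma early_prob k : P (early k) = (early_ratio ^+ k.+1)%:E.
Proof. by rewrite earlyE cyl_prob ?size_iota// iota_uniq. Qed.

Lemma arrivalE k w : arrival E k w = E 0%N w + \sum_(1 <= i < k.+1) E i w.
Proof. by rewrite /arrival -(big_mkord xpredT (E^~ w)) big_ltn. Qed.

Lemma measurable_arrival k : measurable_fun [set: T] (arrival E k).
Proof.
rewrite (_ : arrival E k = fun w => E 0%N w + \sum_(1 <= i < k.+1) E i w).
  by apply: measurable_funD => //; exact: measurable_sum.
by apply/funext => w; exact: arrivalE.
Qed.

Definition window lam t k h : set T :=
  early k `&` [set w | 0 <= lam w * t - arrival E k w <= h].

Lemma measurable_window lam t k h : measurable_fun [set: T] lam ->
  measurable (window lam t k h).
Proof.
move=> mlam; apply: measurableI; first exact: measurable_early.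
rewrite (_ : [set w | _] = (fun w => lam w * t - arrival E k w) @^-1` `[0, h]).
  rewrite -[X in measurable X]setTI.
  apply: (measurable_funB _ (measurable_arrival k)) => //.
  by apply: measurable_funM => //; exact: measurable_cst.
by apply/seteqP; split => w /=; rewrite in_itv/=.
Qed.

(** The first inter-arrival time is spent on the factor [2 h]; the [k] remaining ones give
    [early_ratio ^+ k]. *)
Lemma window_prob_le lam t k h : measurable_fun [set: T] lam -> independent_of lam ->
  0 < h -> (P (window lam t k h) <= (2 * h * early_ratio ^+ k)%:E)%E.
Proof.
move=> mlam ilam h0; have := first_arrival_window_le k mlam ilam L t h0.
rewrite cyl_prob ?iota_uniq// size_iota -EFinM; apply: le_trans.
have mE0 B : measurable B -> measurable (E 0%N @^-1` B).
  by move=> mB; rewrite -[X in measurable X]setTI; exact: mE.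
apply: le_measure; rewrite ?inE; first exact: measurable_window.
- apply: measurableI; first exact: measurable_cylinder.
  rewrite (_ : [set w | _] = E 0%N @^-1` `[0, +oo[ `&`
      (fun w => lam w * t - \sum_(1 <= i < k.+1) E i w - E 0%N w) @^-1` `[0, h]).
    apply: measurableI; first exact: mE0.
    rewrite -[X in measurable X]setTI.
    apply: (measurable_funB _ (mE 0)) => //.
    apply: measurable_funB; first by apply: measurable_funM => //; exact: measurable_cst.
    exact: measurable_sum.
  by apply/seteqP; split => w /=; rewrite !in_itv/= andbT; [move=> /andP|move=> [-> ->]].
- move=> w [ew]; rewrite /= arrivalE opprD addrCA addrC => hw; split.
    move=> i /In_mem; rewrite mem_iota add1n ltnS => /andP[_ ik] /=.
    by rewrite in_itv/= ew.
  by rewrite hw andbT; have /andP[] := ew 0%N isT.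
Qed.

Lemma ae_interarrival_ge0 : {ae P, forall w, forall i, 0 <= E i w}.
Proof.
apply: ae_foralln => i; exists (E i @^-1` `]-oo, 0[); split.
- by rewrite -[X in measurable X]setTI; exact: mE.
- by rewrite /= expE// exponential_prob_lt0.
- by move=> w /= /negP; rewrite -ltNge in_itv.
Qed.

Lemma le_arrival_early w k : (forall i, 0 <= E i w) -> arrival E k w <= L -> early k w.
Proof.
move=> E0 ak i ik; rewrite E0 (le_trans _ ak)//= /arrival.
rewrite (bigD1 (Ordinal (ik : (i < k.+1)%N)))//= lerDl.
exact: sumr_ge0.
Qed.

(** Almost surely only finitely many arrivals fall before [L]: the events [early k] decrease and
    their probabilities tend to [0]. *)
Lemma ae_exists_late : {ae P, forall w, (forall i, 0 <= E i w) -> exists k, ~ early k w}.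
Proof.
exists (\bigcap_k early k); split.
- by apply: bigcap_measurableType => k _; exact: measurable_early.
- apply/eqP; rewrite eq_le measure_ge0 andbT.
  have cv : (early_ratio ^+ k.+1)%:E @[k --> \oo] --> (0%:E : \bar R).
    apply: cvg_EFin; first exact: nearW.
    have := @cvg_expr R early_ratio; rewrite ger0_norm; last by have /andP[] := early_ratio_itv.
    have /andP[_ r1] := early_ratio_itv => /(_ r1).
    by rewrite -(cvg_shiftS (fun k => early_ratio ^+ k)).
  have {}cv : (early_ratio ^+ k.+1)%:E @[k --> \oo] --> (0 : \bar R)%E := cv.
  rewrite -(cvg_lim _ cv)//; apply: lime_ge; first by apply: cvgP cv.
  apply: nearW => k; rewrite -early_prob; apply: le_measure; rewrite ?inE.
  + by apply: bigcap_measurableType => j _; exact: measurable_early.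
  + exact: measurable_early.
  + by move=> w; exact.
- move=> w /= /not_implyP[E0 nk] k _.
  by apply: contrapT => hk; apply: nk; exists k.
Qed.

(** The coincidence lies in windows of every positive width [h], of probability at most [2 h]. It
    must be excluded because the kernel is singular at [u = 0]. *)
Lemma ae_arrival_neq lam t k : measurable_fun [set: T] lam -> independent_of lam ->
  (forall w, lam w * t <= L) ->
  {ae P, forall w, (forall i, 0 <= E i w) -> arrival E k w != lam w * t}.
Proof.
move=> mlam ilam lamL.
pose N := early k `&` [set w | arrival E k w = lam w * t].
have NW h : 0 < h -> N `<=` window lam t k h.
  by move=> h0 w [ew /= aw]; split=> //=; rewrite aw subrr lexx ltW.
have mN : measurable N.
  apply: measurableI; first exact: measurable_early.
  rewrite (_ : [set w | _] = (fun w => arrival E k w - lam w * t) @^-1` [set 0]).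
    rewrite -[X in measurable X]setTI; apply: (measurable_funB (measurable_arrival k)) => //.
    by apply: measurable_funM => //; exact: measurable_cst.
  by apply/seteqP; split => w /=; [move=> ->; rewrite subrr|move=> /eqP; rewrite subr_eq0 => /eqP].
exists N; split=> //.
- apply/eqP; rewrite eq_le measure_ge0 andbT.
  apply/lee_addgt0Pr => e e0; rewrite add0e.
  have e2 : 0 < e / 2 by rewrite divr_gt0.
  apply: (@le_trans _ _ (P (window lam t k (e / 2)))).
    by apply: le_measure; rewrite ?inE//; [exact: measurable_window|exact: NW].
  apply: le_trans (window_prob_le t k mlam ilam e2) _.
  rewrite lee_fin (mulrC 2) divfK// ler_piMr ?(ltW e0)//.
  have /andP[r0 r1] := early_ratio_itv.
  by rewrite exprn_ile1// ltW.
- move=> w /= /not_implyP[E0 /negP]; rewrite negbK => /eqP aw; split=> //.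
  by apply: le_arrival_early => //; rewrite aw.
Qed.

End poisson_arrivals.

(** * Mean square convergence *)

Section nonneg_integral.
Context d (T : measurableType d) (R : realType) (mu : {measure set T -> \bar R}).
Local Open Scope ereal_scope.

(* [f] need not be measurable: its integral is a supremum over simple functions below [f]. *)
Lemma ge0_ae_le_integral_nonmeasurable (f g : T -> \bar R) :
  (forall x, 0 <= f x) -> (forall x, 0 <= g x) -> measurable_fun [set: T] g ->
  {ae mu, forall x, f x <= g x} ->
  \int[mu]_x f x <= \int[mu]_x g x.
Proof.
move=> f0 g0 mg [N [mN N0 sub]].
(* Adding [+oo] on the null set makes the inequality hold everywhere and leaves the integral of [g]
   unchanged. *)
pose g' x := g x + +oo * (\1_N x)%:E.
have g'0 x : 0 <= g' x by rewrite adde_ge0// mule_ge0// lee_fin.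
have mg' : measurable_fun [set: T] g'.
  apply: emeasurable_funD => //; apply: measurable_funeM.
  by apply/measurable_EFinP; exact: measurable_indic.
have -> : \int[mu]_x g x = \int[mu]_x g' x.
  apply: ge0_ae_eq_integral => //; exists N; split => // x /= /not_implyP[_ gg'].
  apply: contrapT => Nx; apply: gg'.
  by rewrite /g' indicE memNset//= mule0 adde0.
rewrite !ge0_integralTE//; apply: ereal_sup_le => _ [h hf <-]; exists h => // x.
apply: le_trans (hf x) _; rewrite /g' indicE.
have [/set_mem Nx|/negP Nx] := boolP (x \in N).
  by rewrite /= mule1 addey ?leey// gt_eqF// (lt_le_trans _ (g0 x))// ltNy0.
rewrite /= mule0 adde0; apply: contrapT => fg; apply: Nx; apply/mem_set.
exact: sub.
Qed.

Lemma nneseries_geometric_le (c z : R) : (0 <= c)%R -> (0 <= z < 1)%R ->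
  \sum_(k <oo) (c * z ^+ k)%:E <= (c / (1 - z))%:E.
Proof.
move=> c0 /[dup] z01 /andP[z0 z1]; apply: lime_le.
  by apply: is_cvg_nneseries => k _ _; rewrite lee_fin mulr_ge0// exprn_ge0.
by apply: nearW => n; rewrite sumEFin lee_fin; exact: series_geometric_le.
Qed.

Lemma ge0_cvge0 (u : nat -> \bar R) : (forall n, 0 <= u n) ->
  (forall e : R, (0 < e)%R -> \forall n \near \oo, u n <= e%:E) ->
  u n @[n --> \oo] --> 0.
Proof.
move=> u0 ue; apply/fine_cvgP; split.
  apply: filterS (ue 1%R ltr01) => n un.
  by rewrite ge0_fin_numE// (le_lt_trans un) ?ltry.
apply/cvgrPdist_le => e e0; apply: filterS (ue e e0) => n un.
have fu : u n \is a fin_num by rewrite ge0_fin_numE// (le_lt_trans un) ?ltry.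
by rewrite sub0r normrN ger0_norm ?fine_ge0// -lee_fin fineK.
Qed.

Lemma ge0_cvge0_le (u : nat -> \bar R) : (forall n, 0 <= u n) ->
  u n @[n --> \oo] --> 0 ->
  forall e : R, (0 < e)%R -> \forall n \near \oo, u n <= e%:E.
Proof.
move=> u0 /fine_cvgP[fu /cvgrPdist_le cu] e e0.
near=> n; have fn : u n \is a fin_num by near: n.
have : (`|0 - fine (u n)| <= e)%R by near: n; exact: cu.
by rewrite sub0r normrN ger0_norm ?fine_ge0// -lee_fin fineK.
Unshelve. all: by end_near. Qed.

(** Dominated convergence up to a small error, a form of uniform integrability: [min (Y n) H] tends
    to [0] under the majorant [H], and [Y n <= min (Y n) H + Z n]. *)
Lemma almost_dominated_cvg0 (Y : nat -> T -> \bar R) :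
  (forall n, measurable_fun [set: T] (Y n)) -> (forall n x, 0 <= Y n x) ->
  {ae mu, forall x, Y n x @[n --> \oo] --> 0} ->
  (forall e : R, (0 < e)%R -> exists (H : T -> \bar R) (Z : nat -> T -> \bar R),
    [/\ mu.-integrable [set: T] H, forall x, 0 <= H x,
     forall n, measurable_fun [set: T] (Z n) /\ forall x, 0 <= Z n x,
     {ae mu, forall x, forall n, Y n x <= H x + Z n x} &
     forall n, \int[mu]_x Z n x <= e%:E]) ->
  \int[mu]_x Y n x @[n --> \oo] --> 0.
Proof.
move=> mY Y0 cY hY; apply: ge0_cvge0 => [n|e e0]; first exact: integral_ge0.
have e2 : (0 < e / 2)%R by rewrite divr_gt0.
have [H [Z [iH H0 mZ YHZ iZ]]] := hY _ e2.
have mH := measurable_int mu iH.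
have minH0 n x : 0 <= mine (Y n x) (H x) by rewrite le_min Y0 H0.
have [|||||_ _] := @dominated_convergence _ _ _ mu _ measurableT
  (fun n x => mine (Y n x) (H x)) (cst 0) H.
- by move=> n; exact: measurable_mine.
- exact: measurable_cst.
- apply: filterS cY => x cYx _; apply: ge0_cvge0 => // f f0.
  apply: filterS (ge0_cvge0_le (Y0^~ x) cYx f0) => n; apply: le_trans.
  by rewrite ge_min lexx.
- exact: iH.
- by apply: aeW => x n _; rewrite gee0_abs// ge_min lexx orbT.
rewrite integral0 => cm.
have m0 n : 0 <= \int[mu]_x mine (Y n x) (H x) by exact: integral_ge0.
apply: filterS (ge0_cvge0_le m0 cm e2) => n mn.
have [mZn Zn0] := mZ n.
apply: (@le_trans _ _ (\int[mu]_x (mine (Y n x) (H x) + Z n x))).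
  apply: ge0_ae_le_integral_nonmeasurable => //.
  - by move=> x; rewrite adde_ge0.
  - by apply: emeasurable_funD => //; exact: measurable_mine.
  - apply: filterS YHZ => x /(_ n) YHZ.
    have [YH|HY] := leP (Y n x) (H x); last exact: YHZ.
    by rewrite leeDl.
rewrite ge0_integralD//; last exact: measurable_mine.
by rewrite [e]splitr EFinD leeD.
Qed.

End nonneg_integral.

Lemma limn_series_eventually0 (R : realType) (u : nat -> R) K :
  (forall k, (K <= k)%N -> u k = 0) -> limn (series u) = \sum_(0 <= k < K) u k.
Proof.
move=> u0; apply/cvg_lim => //; apply: cvg_near_cst; near=> n.
have Kn : (K <= n)%N by near: n; exact: nbhs_infty_ge.
rewrite /series/= (big_cat_nat (leq0n K) Kn)/= [X in _ + X]big1_seq ?addr0// => k.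
by rewrite mem_index_iota => /andP[_ /andP[/u0]].
Unshelve. all: by end_near. Qed.

(** * The signal paired with a test function *)

Section signal.
Context (R : realType) d (T : measurableType d) (P : probability T R).
Variables (a b alpha t M : R) (phi : R -> R) (E : nat -> T -> R).
Hypotheses (a0 : 0 < a) (alpha0 : 0 < alpha) (t0 : 0 < t) (M0 : 0 < M).
Notation mu := (@lebesgue_measure R).
Notation D := (`[0%R, 1%R]%classic : set R).
Hypothesis bphi : bounded_measurable D phi.
Hypothesis hE : std_poisson_interarrivals P E.

(** A horizon in the clock of the unit-rate process, common to all admissible [lambda] since
    [lambda * t <= M * t]. *)
Let L := M * t.
Let L0 : 0 < L. Proof. exact: mulr_gt0. Qed.
Let r := early_ratio L.
Let r01 : 0 <= r < 1. Proof. exact: early_ratio_itv. Qed.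

Definition admissible (beta lambda : R) := 0 < beta < 1 /\ 0 < lambda <= M.

Lemma admissible01 beta lambda : admissible beta lambda -> D beta.
Proof. by move=> [/andP[b0 b1] _]; rewrite /= in_itv/= !ltW. Qed.

Definition jump_pairing (beta lambda : R) (k : nat) (w : T) : R :=
  kernel_pairing a b alpha phi beta (t - arrival E k w / lambda).

Lemma jump_pairing_late beta lambda k w : admissible beta lambda ->
  lambda * t <= arrival E k w -> jump_pairing beta lambda k w = 0.
Proof.
move=> [_ /andP[l0 lM]] ak; rewrite /jump_pairing /kernel_pairing ltNge.
suff -> : t - arrival E k w / lambda <= 0 by [].
by rewrite subr_le0 ler_pdivlMr// mulrC.
Qed.

Lemma late_arrival_gt beta lambda k w : admissible beta lambda ->
  (forall i, 0 <= E i w) -> ~ early E L k w -> lambda * t < arrival E k w.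
Proof.
move=> [_ /andP[l0 lM]] E0 nk; rewrite ltNge; apply/negP => ak; apply: nk.
by apply: le_arrival_early => //; rewrite (le_trans ak)// ler_pM2r.
Qed.

Lemma late_nondecreasing w K k : ~ early E L K w -> (K <= k)%N -> ~ early E L k w.
Proof. by move=> nK Kk ek; apply: nK => i iK; apply: ek; exact: leq_trans Kk. Qed.

(** Off the exceptional outcomes the jump series is a finite sum, each of whose nonzero terms is
    taken at a positive time and is bounded, so that the pairing is additive. The contribution of
    [nu] does not involve [beta] or [lambda]. *)
Lemma pairing_Udens (nu : {finite_measure set R -> \bar R}) beta lambda w K :
  admissible beta lambda -> (forall i, 0 <= E i w) -> ~ early E L K w ->
  (forall k, arrival E k w != lambda * t) ->
  pairing (Udens a b alpha t nu E beta lambda w) phi =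
  pairing (fun x => expR (- (alpha * t)) *
    fine (\int[nu]_(y in `[0, 1]) (Pker a b t y x)%:E)) phi +
  \sum_(0 <= k < K) jump_pairing beta lambda k w.
Proof.
move=> adm E0 nK neq; have [_ /andP[l0 lM]] := adm.
have Db := admissible01 adm.
pose term k x := if arrival E k w / lambda <= t then
  expR (- (alpha * (t - arrival E k w / lambda))) *
  Pker a b (t - arrival E k w / lambda) beta x else 0.
have fin := @lebesgue_measure01_lty R.
have termE k : arrival E k w / lambda <= t -> 0 < t - arrival E k w / lambda.
  rewrite subr_gt0 lt_neqAle => ->; rewrite andbT.
  apply: contra (neq k) => /eqP <-.
  by rewrite mulrC divfK// gt_eqF.
have bterm k : bounded_measurable D (term k).
  have [ak|ak] := boolP (arrival E k w / lambda <= t); last first.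
    by rewrite /term (negbTE ak); exact: bounded_measurable_cst.
  rewrite /term ak; have u0 := termE _ ak; have [s0 su] := sqrtr_sqr_le u0.
  by apply: bounded_measurableZ; exact: bounded_measurable_Pker s0 su _ Db.
have [s0 su] := sqrtr_sqr_le t0.
have bA := bounded_measurable_Pker_integral b a0 s0 su nu.
have UE x : Udens a b alpha t nu E beta lambda w x =
    expR (- (alpha * t)) * fine (\int[nu]_(y in `[0, 1]) (Pker a b t y x)%:E) +
    \sum_(0 <= k < K) term k x.
  rewrite /Udens; congr (_ + _); apply: limn_series_eventually0 => k Kk /=.
  rewrite ler_pdivrMr// mulrC leNgt (late_arrival_gt adm)//.
  exact: late_nondecreasing nK Kk.
rewrite /pairing.
have -> : Rintegral mu D (fun x => Udens a b alpha t nu E beta lambda w x * phi x) =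
  Rintegral mu D (fun x => expR (- (alpha * t)) *
    fine (\int[nu]_(y in `[0, 1]) (Pker a b t y x)%:E) * phi x +
    \sum_(0 <= k < K) term k x * phi x).
  by apply: eq_Rintegral => x _; rewrite UE mulrDl mulr_suml.
rewrite RintegralD//; last 2 first.
- apply: bounded_measurable_integrable => //; apply: bounded_measurableM => //.
  exact: bounded_measurableZ.
- apply: bounded_measurable_integrable => //; apply: bounded_measurable_sum => k.
  exact: (bounded_measurableM (bterm k) bphi).
congr (_ + _); rewrite (@Rintegral_sum_nat _ _ _ mu D)//; last first.
  by move=> k; exact: (bounded_measurableM (bterm k) bphi).
apply: eq_bigr => k _; have [ak|ak] := boolP (arrival E k w / lambda <= t).
  by rewrite /term ak Rintegral_PkerM//; exact: termE.
rewrite /term (negbTE ak) jump_pairing_late//; last first.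
  by move: ak; rewrite -ltNge ltr_pdivlMr// mulrC => /ltW.
under eq_Rintegral do rewrite mul0r.
by rewrite Rintegral_cst// mul0r.
Qed.

Section bounds.
Variable C : R.
Hypothesis C0 : 0 <= C.
Hypothesis kernel_le : forall m u beta, D beta ->
  ((4 ^+ m)^-1) ^+ 2 <= u -> kernel_pairing a b alpha phi beta u ^+ 2 <= C * 4 ^+ m.

(** A time [u <= 16^-m] before observation is at most [M * 16^-m] in the clock of [E], where it
    becomes [lambda * u]. *)
Let radius (m : nat) : R := M * ((4 ^+ m)^-1) ^+ 2.

Let radius_gt0 m : 0 < radius m.
Proof. by rewrite mulr_gt0// exprn_gt0// invr_gt0 exprn_gt0. Qed.

(** The term [l] covers [16^-(m+l+1) <= u < 16^-(m+l)]: the lower end fixes the height [4^(m+l+1)],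
    the upper end the window. *)
Definition jump_tail (lam : T -> R) (m k : nat) (w : T) : \bar R :=
  (\sum_(l <oo) (C * 4 ^+ (m + l).+1)%:E * (\1_(window E L lam t k (radius (m + l))) w)%:E)%E.

Lemma jump_tail_ge0 lam m k w : (0 <= jump_tail lam m k w)%E.
Proof.
by apply: nneseries_ge0 => l _ _; rewrite mule_ge0// lee_fin// mulr_ge0// exprn_ge0.
Qed.

Lemma measurable_jump_tail lam m k : measurable_fun [set: T] lam ->
  measurable_fun [set: T] (jump_tail lam m k).
Proof.
move=> mlam; apply: (ge0_emeasurable_sum (P := xpredT)) => [l w _ _|l _].
  by rewrite mule_ge0// lee_fin// mulr_ge0// exprn_ge0.
apply: measurable_funeM; apply/measurable_EFinP; apply: measurable_indic.
exact: (measurable_window hE).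
Qed.

(* Dyadic decomposition of the singularity of the kernel at time 0. *)
Lemma jump_pairing_sqr_le (bet lam : T -> R) m k w :
  admissible (bet w) (lam w) -> (forall i, 0 <= E i w) ->
  ((jump_pairing (bet w) (lam w) k w ^+ 2)%:E <=
   (C * 4 ^+ m)%:E * (\1_(early E L k) w)%:E + jump_tail lam m k w)%E.
Proof.
move=> adm E0; have Db := admissible01 adm; have [_ /andP[l0 lM]] := adm.
have CE : (0 <= (C * 4 ^+ m)%:E * (\1_(early E L k) w)%:E)%E.
  by rewrite mule_ge0// lee_fin// mulr_ge0// exprn_ge0.
have [ak|ak] := leP (lam w * t) (arrival E k w).
  rewrite jump_pairing_late// expr0n/=.
  by rewrite adde_ge0//; exact: jump_tail_ge0.
pose u := t - arrival E k w / lam w.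
have u0 : 0 < u by rewrite subr_gt0 ltr_pdivrMr// mulrC.
have ek : early E L k w.
  apply: le_arrival_early => //; rewrite (le_trans (ltW ak))//.
  by rewrite ler_pM2r.
have [mu_|mu_] := leP (((4 ^+ m)^-1) ^+ 2) u.
  apply: (@le_trans _ _ (C * 4 ^+ m)%:E); first by rewrite lee_fin kernel_le.
  by rewrite indicE mem_set//= mule1 leeDl//; exact: jump_tail_ge0.
have ex : exists p, ((4 ^+ p)^-1) ^+ 2 <= u.
  have z01 : `|(16 : R)^-1| < 1 by rewrite ger0_norm// invf_lt1// ltr1n.
  have /cvgrPdist_le/(_ _ u0)[p _ /(_ p (leqnn p))/=] := @cvg_expr R _ z01.
  rewrite sub0r normrN ger0_norm ?exprn_ge0// => h; exists p.
  by rewrite -exprVn -exprM mulnC exprM exprVn -natrX.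
(* Minimality of [p] gives [u < 16^-(p-1)]; with [p = m + l + 1] this is the upper end of the scale
   [l]. *)
have [p hp pmin] := ex_minnP ex.
have mp : (m < p)%N.
  rewrite ltnNge; apply/negP => pm; move: mu_; rewrite ltNge => /negP; apply.
  apply: le_trans hp; rewrite ler_sqr ?nnegrE ?invr_ge0 ?exprn_ge0//.
  by rewrite lef_pV2 ?posrE ?exprn_gt0// ler_eXn2l// ltr1n.
pose l := (p - m.+1)%N.
have pE : p = (m + l).+1 by rewrite -addSn subnKC.
have ul : u < ((4 ^+ (m + l))^-1) ^+ 2.
  by rewrite ltNge; apply/negP => /pmin; rewrite pE ltnn.
have ww : window E L lam t k (radius (m + l)) w.
  split=> //=; have lu : lam w * t - arrival E k w = lam w * u.
    by rewrite /u mulrBr mulrCA divff ?mulr1// gt_eqF.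
  rewrite lu; apply/andP; split; first by rewrite mulr_ge0// ltW.
  by rewrite /radius; apply: ler_pM => //; exact: ltW.
apply: (@le_trans _ _ (jump_tail lam m k w)); last by rewrite leeDr.
apply: (@le_trans _ _ (\sum_(0 <= l' < l.+1) (C * 4 ^+ (m + l').+1)%:E *
    (\1_(window E L lam t k (radius (m + l'))) w)%:E)%E); last first.
  apply: nneseries_lim_ge => l' _ _.
  by rewrite mule_ge0// lee_fin// mulr_ge0// exprn_ge0.
rewrite big_nat_recr//= [X in (_ + _ * X)%E]/= indicE mem_set//= mule1.
apply: (@le_trans _ _ (C * 4 ^+ (m + l).+1)%:E).
  by rewrite lee_fin -pE; exact: kernel_le.
rewrite leeDr// sume_ge0// => l' _.
by rewrite mule_ge0// lee_fin// mulr_ge0// exprn_ge0.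
Qed.

(** Height times probability at the scale [l] is [C 4^(m+l+1) * 2 M 16^-(m+l) * r^k = 8 C M 4^-(m+l)
    r^k]. Summing over [l] multiplies by [4/3], and [32/3] is rounded up to [16]. *)
Lemma integral_jump_tail lam m k : measurable_fun [set: T] lam ->
  independent_of P E lam ->
  (\int[P]_w jump_tail lam m k w <= (16 * C * M * (4 ^+ m)^-1 * r ^+ k)%:E)%E.
Proof.
move=> mlam ilam; have [r0 r1] := andP r01.
have mw h : measurable (window E L lam t k h) by exact: (measurable_window hE).
rewrite integral_nneseries//; last 2 first.
- move=> l; apply: measurable_funeM; apply/measurable_EFinP; exact: measurable_indic.
- by move=> l w _; rewrite mule_ge0// lee_fin// mulr_ge0// exprn_ge0.
pose c := 8 * C * M * (4 ^+ m)^-1 * r ^+ k.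
have c0 : 0 <= c by rewrite !mulr_ge0 ?invr_ge0 ?exprn_ge0// ltW.
apply: (@le_trans _ _ (\sum_(l <oo) (c * (4^-1) ^+ l)%:E)%E).
  apply: lee_nneseries => [l _ _|l _].
    by apply: integral_ge0 => w _; rewrite mule_ge0// lee_fin// mulr_ge0// exprn_ge0.
  rewrite ge0_integralZl_EFin//; last 2 first.
  - apply/measurable_EFinP; exact: measurable_indic.
  - by rewrite mulr_ge0// exprn_ge0.
  rewrite integral_indic// setIT.
  apply: (@le_trans _ _ ((C * 4 ^+ (m + l).+1)%:E * (2 * radius (m + l) * r ^+ k)%:E)%E).
    apply: lee_wpmul2l; first by rewrite lee_fin mulr_ge0// exprn_ge0.
    exact: window_prob_le.
  rewrite -EFinM lee_fin /radius /c exprS exprD (exprVn 4 l).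
  have x0 : (4 ^+ m : R) != 0 by rewrite expf_neq0.
  have y0 : (4 ^+ l : R) != 0 by rewrite expf_neq0.
  move: (4 ^+ m) (4 ^+ l) (r ^+ k) x0 y0 => x y z x0 y0.
  by rewrite le_eqVlt; apply/orP; left; apply/eqP; field; rewrite x0 y0.
apply: le_trans (nneseries_geometric_le c0 _) _.
  by rewrite invr_ge0 ler0n/= invf_lt1// ltr1n.
rewrite lee_fin ler_pdivrMr; last by rewrite subr_gt0 invf_lt1// ltr1n.
rewrite [leRHS](_ : _ = 2 * c * (1 - 4^-1)); last by rewrite /c; ring.
rewrite -subr_ge0 (_ : _ - _ = c * (1 / 2)); last by field.
by rewrite mulr_ge0// divr_ge0.
Qed.

End bounds.

(** * Increments between the estimated and the true parameter *)

Section increments.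
Variables (bet lam : nat -> T -> R) (beta0 lambda0 : R).
Hypotheses (mbet : forall n, measurable_fun [set: T] (bet n))
  (mlam : forall n, measurable_fun [set: T] (lam n))
  (adm : forall n w, admissible (bet n w) (lam n w))
  (adm0 : admissible beta0 lambda0)
  (ilam : forall n, independent_of P E (lam n))
  (cvgs : {ae P, forall w, bet n w @[n --> \oo] --> beta0 /\
                           lam n w @[n --> \oo] --> lambda0}).

Let ilam0 : independent_of P E (fun=> lambda0). Proof. exact: independent_of_cst. Qed.

(* [q ^ 2] lies strictly between [r] and [1], so the weights [q ^ (2 k)] are summable
   and [(r / q ^ 2) ^ k] is too. *)
Let q := (1 + r) / 2.
Let q0 : 0 < q.
Proof. by have /andP[? _] := r01; rewrite divr_gt0// ltr_wpDr. Qed.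
Let q1 : q ^+ 2 < 1.
Proof.
have /andP[? ?] := r01; rewrite expr_lt1// ?ltW//.
by rewrite /q ltr_pdivrMr// mul1r; lra.
Qed.
Let rq : 0 <= r / q ^+ 2 < 1.
Proof.
have /andP[? r1] := r01; rewrite divr_ge0 ?sqr_ge0//= ltr_pdivrMr ?exprn_gt0// mul1r.
rewrite -subr_gt0 (_ : _ - _ = ((1 - r) / 2) ^+ 2); last by rewrite /q; field.
by rewrite exprn_gt0// divr_gt0// subr_gt0.
Qed.
Let Q := (1 - q ^+ 2)^-1.
Let Q0 : 0 < Q. Proof. by rewrite invr_gt0 subr_gt0. Qed.

Let X n k w := jump_pairing (bet n w) (lam n w) k w - jump_pairing beta0 lambda0 k w.

(** Writing [X = q^k * (X / q^k)], Cauchy-Schwarz leaves [q^(-2k) X^2] and the factor [Q], which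
    bounds the sum of the [q^(2k)]. *)
Let weight k := Q * ((q ^+ 2)^-1) ^+ k.
Let weight_ge0 k : 0 <= weight k.
Proof.
by apply: mulr_ge0; [exact: ltW|rewrite exprn_ge0// invr_ge0 sqr_ge0].
Qed.

Let weight2_ge0 k : 0 <= 2 * weight k.
Proof. by apply: mulr_ge0 => //; exact: weight_ge0. Qed.

Let weightX_ge0 n k w : 0 <= weight k * X n k w ^+ 2.
Proof. by apply: mulr_ge0; [exact: weight_ge0|exact: sqr_ge0]. Qed.

Let weightC_ge0 k m C : 0 <= C -> 0 <= weight k * (4 * C * 4 ^+ m).
Proof.
move=> C0; apply: mulr_ge0; first exact: weight_ge0.
by rewrite !mulr_ge0// exprn_ge0.
Qed.

(** Summation over all [k], rather than up to the random number of jumps, gives a measurable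
    majorant of the squared increment. *)
Let Y n w : \bar R := (\sum_(k <oo) (weight k * X n k w ^+ 2)%:E)%E.

Let sum_sqr_le n K w :
  (\sum_(0 <= k < K) X n k w) ^+ 2 <= \sum_(0 <= k < K) weight k * X n k w ^+ 2.
Proof.
have -> : \sum_(0 <= k < K) X n k w = \sum_(0 <= k < K) q ^+ k * (X n k w / q ^+ k).
  by apply: eq_bigr => k _; rewrite mulrCA divff ?mulr1// expf_neq0// gt_eqF.
apply: le_trans (sqr_sum_mul_le _ _ _) _.
have -> : \sum_(0 <= k < K) weight k * X n k w ^+ 2 =
    Q * \sum_(0 <= k < K) (X n k w / q ^+ k) ^+ 2.
  rewrite mulr_sumr; apply: eq_bigr => k _; rewrite /weight -mulrA; congr (_ * _).
  have -> : ((q ^+ 2)^-1) ^+ k = ((q ^+ k) ^+ 2)^-1.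
    by rewrite (exprVn (q ^+ 2)) -!(exprM q) mulnC.
  by rewrite (expr_div_n (X n k w)) mulrC.
apply: ler_wpM2r; first by apply: sumr_ge0 => k _; exact: sqr_ge0.
rewrite (eq_bigr (fun k => 1 * (q ^+ 2) ^+ k)); last first.
  by move=> k _; rewrite mul1r -!exprM mulnC.
apply: le_trans (series_geometric_le _ _ _) _ => //; last by rewrite div1r.
by rewrite sqr_ge0.
Qed.

Let mX n k : measurable_fun [set: T] (X n k).
Proof.
have mak := measurable_arrival hE k.
apply: measurable_funB; apply: measurable_kernel_pairing => //.
- by move=> w; exact: admissible01 (adm n w).
- apply: measurable_funB => //; apply: measurable_funM => //.
  (* For positive values the inverse is a composition of the measurable functions [ln] and
     [expR]. *)
  have -> : (fun w => (lam n w)^-1) = (fun w => expR (- 1 * ln (lam n w))).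
    apply/funext => w; rewrite mulN1r expRN lnK// posrE.
    by have [_ /andP[]] := adm n w.
  apply: (@measurableT_comp _ _ _ _ _ _ expR) => //; apply: measurable_funM => //.
  exact: measurableT_comp.
- by move=> w; exact: admissible01 adm0.
- by apply: measurable_funB => //; exact: measurable_funM.
Qed.

Let mY n : measurable_fun [set: T] (Y n).
Proof.
apply: (ge0_emeasurable_sum (P := xpredT)) => [k w _ _|k _].
  by rewrite lee_fin.
apply/measurable_EFinP; apply: measurable_funM => //.
exact: measurable_funX.
Qed.

Let Y0 n w : (0 <= Y n w)%E.
Proof. by apply: nneseries_ge0 => k _ _; rewrite lee_fin. Qed.

Let good w := [/\ forall i, 0 <= E i w, exists K, ~ early E L K w,
  forall n k, arrival E k w != lam n w * t,
  forall k, arrival E k w != lambda0 * t &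
  bet n w @[n --> \oo] --> beta0 /\ lam n w @[n --> \oo] --> lambda0].

Let lamL n w : lam n w * t <= L.
Proof. by have [_ /andP[_ ?]] := adm n w; rewrite ler_pM2r. Qed.

Let ae_good : {ae P, forall w, good w}.
Proof.
have h1 := ae_interarrival_ge0 hE.
have h2 := ae_exists_late hE L0.
have h3 : {ae P, forall w, forall n k, (forall i, 0 <= E i w) -> arrival E k w != lam n w * t}.
  apply: ae_foralln => n; apply: ae_foralln => k.
  by apply: (ae_arrival_neq hE L0).
have h4 : {ae P, forall w, forall k, (forall i, 0 <= E i w) -> arrival E k w != lambda0 * t}.
  apply: ae_foralln => k; apply: (ae_arrival_neq hE L0 (lam := fun=> lambda0)) => //.
  by move=> w; have [_ /andP[_ ?]] := adm0; rewrite ler_pM2r.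
near=> w.
have g1 : forall i, 0 <= E i w by near: w.
have g2 : (forall i, 0 <= E i w) -> exists K, ~ early E L K w by near: w.
have g3 : forall n k, (forall i, 0 <= E i w) -> arrival E k w != lam n w * t by near: w.
have g4 : forall k, (forall i, 0 <= E i w) -> arrival E k w != lambda0 * t by near: w.
have g5 : bet n w @[n --> \oo] --> beta0 /\ lam n w @[n --> \oo] --> lambda0 by near: w.
by split=> // [|n k|k]; [exact: g2|exact: g3|exact: g4].
Unshelve. all: by end_near. Qed.

Let X_late n w K k : (forall i, 0 <= E i w) -> ~ early E L K w -> (K <= k)%N -> X n k w = 0.
Proof.
move=> E0 nK Kk; have nk := late_nondecreasing nK Kk.
rewrite /X !jump_pairing_late// ?subrr//.
- by apply: ltW; exact: late_arrival_gt adm0 _ _.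
- by apply: ltW; exact: late_arrival_gt (adm n w) _ _.
Qed.

Let YE n w K : (forall i, 0 <= E i w) -> ~ early E L K w ->
  Y n w = (\sum_(0 <= k < K) weight k * X n k w ^+ 2)%:E.
Proof.
move=> E0 nK; rewrite /Y (nneseries_split 0 K); last first.
  by move=> k _; rewrite lee_fin.
rewrite add0n [X in (_ + X)%E]eseries0 ?adde0 ?sumEFin// => k Kk _.
by rewrite (X_late _ E0 nK Kk) expr0n/= mulr0.
Qed.

Lemma pairing_increment_le_ae (U0 : T -> {finite_measure set R -> \bar R}) n :
  {ae P, forall w, (((pairing (Udens a b alpha t (U0 w) E (bet n w) (lam n w) w) phi
       - pairing (Udens a b alpha t (U0 w) E beta0 lambda0 w) phi) ^+ 2)%:E <= Y n w)%E}.
Proof.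
apply: filterS ae_good => w [E0 [K nK] neq neq0 _].
rewrite (pairing_Udens _ (adm n w) E0 nK (neq n)) (pairing_Udens _ adm0 E0 nK neq0).
rewrite opprD addrACA subrr add0r -sumrB (YE n E0 nK) lee_fin.
exact: sum_sqr_le.
Qed.

(** The cutoff [K] depends on the outcome but not on [n], as [early] refers to [L] only; what
    remains is a fixed finite sum of null sequences. *)
Let Y_cvg0 : {ae P, forall w, Y n w @[n --> \oo] --> 0%E}.
Proof.
apply: filterS ae_good => w [E0 [K nK] neq neq0 [cb cl]].
have -> : Y^~ w = fun n => (\sum_(0 <= k < K) weight k * X n k w ^+ 2)%:E.
  by apply/funext => n; exact: YE.
apply: cvg_EFin; first exact: nearW.
have l00 : lambda0 != 0 by have [_ /andP[? _]] := adm0; rewrite gt_eqF.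
rewrite [X in _ --> X](_ : _ = \sum_(0 <= k < K) weight k * 0 ^+ 2); last first.
  by rewrite big1// => k _; rewrite expr0n/= mulr0.
apply: cvg_big => [|k _]; first exact: add_continuous.
apply: cvgM; first exact: cvg_cst.
have Xk : X n k w @[n --> \oo] --> (0 : R).
  rewrite -(subrr (jump_pairing beta0 lambda0 k w)).
  apply: cvgB; last exact: cvg_cst.
  apply: (kernel_pairing_cvg a0 bphi (beta := fun n => bet n w)
    (u := fun n => t - arrival E k w / lam n w)) => //.
  - by move=> n; exact: admissible01 (adm n w).
  - rewrite subr_eq0; apply: contra (neq0 k) => /eqP ->.
    by rewrite mulrC divfK.
  - apply: cvgB; first exact: cvg_cst.
    apply: cvgM; first exact: cvg_cst.
    exact: cvgV.
under eq_fun do rewrite expr2.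
by rewrite expr2; exact: cvgM.
Qed.

(** The first sum is free of [n], the second carries the singular part. The constant [4] comes from
    [(x - y)^2 <= 2 (x^2 + y^2)] and the two equal bounds [C 4^m]. *)
Let Y_le_split C m n w : 0 <= C ->
  (forall m u beta, D beta -> ((4 ^+ m)^-1) ^+ 2 <= u ->
    kernel_pairing a b alpha phi beta u ^+ 2 <= C * 4 ^+ m) ->
  (forall i, 0 <= E i w) ->
  (Y n w <= \sum_(k <oo) (weight k * (4 * C * 4 ^+ m))%:E * (\1_(early E L k) w)%:E +
    \sum_(k <oo) (2 * weight k)%:E *
      (jump_tail C (lam n) m k w + jump_tail C (fun=> lambda0) m k w))%E.
Proof.
move=> C0 hC E0.
have t1 k := jump_tail_ge0 C0 (lam n) m k w.
have t2 k := jump_tail_ge0 C0 (fun=> lambda0) m k w.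
rewrite -nneseriesD; last 2 first.
- by move=> k _ _; rewrite mule_ge0 ?lee_fin// weightC_ge0.
- by move=> k _ _; apply: mule_ge0; [rewrite lee_fin|exact: adde_ge0].
apply: lee_nneseries => k _; first by rewrite lee_fin.
have f1 := jump_pairing_sqr_le C0 hC (bet := bet n) m k (adm n w) E0.
have f2 := jump_pairing_sqr_le C0 hC (bet := fun=> beta0) (lam := fun=> lambda0)
  m k (w := w) adm0 E0.
set A := \1_(early E L k) w in f1 f2 *.
set J1 := jump_tail C (lam n) m k w in f1 *.
set J2 := jump_tail C (fun=> lambda0) m k w in f2 *.
apply: (@le_trans _ _ ((2 * weight k)%:E * ((C * 4 ^+ m)%:E * A%:E + J1 + ((C * 4 ^+ m)%:E * A%:E + J2)))%E).
  apply: (@le_trans _ _ ((2 * weight k)%:E * ((jump_pairing (bet n w) (lam n w) k w ^+ 2)%:E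
      + (jump_pairing beta0 lambda0 k w ^+ 2)%:E))%E).
    have hX : X n k w ^+ 2 <= 2 * (jump_pairing (bet n w) (lam n w) k w ^+ 2
        + jump_pairing beta0 lambda0 k w ^+ 2).
      rewrite /X; move: (jump_pairing _ _ _ _) (jump_pairing _ _ _ _) => x y.
      rewrite -subr_ge0 (_ : _ - _ = (x + y) ^+ 2); first exact: sqr_ge0.
      by ring.
    rewrite -EFinD -EFinM lee_fin.
    apply: le_trans (ler_wpM2l (weight_ge0 k) hX) _.
    by rewrite (mulrCA (weight k)) -(mulrA 2 (weight k)).
  apply: lee_wpmul2l; first by rewrite lee_fin.
  exact: leeD.
have A0 : 0 <= A by [].
rewrite addeACA ge0_muleDr//; last 2 first.
- by rewrite adde_ge0// mule_ge0// lee_fin// mulr_ge0// exprn_ge0.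
- by apply: adde_ge0; [exact: t1|exact: t2].
apply: leeD => //; rewrite -!EFinM lee_fin.
by rewrite le_eqVlt; apply/orP; left; apply/eqP; ring.
Qed.

Let weightE k : weight k * r ^+ k = Q * (r / q ^+ 2) ^+ k.
Proof.
have -> : (r / q ^+ 2) ^+ k = ((q ^+ 2)^-1) ^+ k * r ^+ k by rewrite exprMn mulrC.
by rewrite mulrA.
Qed.

Let early_sum C m w : \bar R :=
  (\sum_(k <oo) (weight k * (4 * C * 4 ^+ m))%:E * (\1_(early E L k) w)%:E)%E.

Let early_sum_term_ge0 C m k w : 0 <= C ->
  (0 <= (weight k * (4 * C * 4 ^+ m))%:E * (\1_(early E L k) w)%:E)%E.
Proof. by move=> C0; rewrite mule_ge0 ?lee_fin// weightC_ge0. Qed.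

(** The weights [q^(-2k)] are beaten by [P (early k) = r^(k+1)]. The bound grows with [m], which is
    harmless since [m] is fixed before [n]. *)
Let integrable_early_sum C m : 0 <= C -> P.-integrable [set: T] (early_sum C m).
Proof.
move=> C0; have /andP[r0 r1] := r01.
have t0' k w := early_sum_term_ge0 m k w C0.
have mt k : measurable_fun [set: T]
    (fun w => (weight k * (4 * C * 4 ^+ m))%:E * (\1_(early E L k) w)%:E)%E.
  apply: measurable_funeM; apply/measurable_EFinP; apply: measurable_indic.
  exact: (measurable_early hE).
apply/integrableP; split.
  by apply: (ge0_emeasurable_sum (P := xpredT)).
under eq_integral => w _ do rewrite gee0_abs ?nneseries_ge0//.
rewrite integral_nneseries//.
pose c := 4 * C * 4 ^+ m * Q.
have c0 : 0 <= c by rewrite !mulr_ge0 ?exprn_ge0// ltW.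
apply: (@le_lt_trans _ _ (\sum_(k <oo) (c * (r / q ^+ 2) ^+ k)%:E)%E); last first.
  by apply: le_lt_trans (nneseries_geometric_le c0 rq) _; rewrite ltry.
apply: lee_nneseries => [k _ _|k _]; first by apply: integral_ge0 => w _; exact: t0'.
rewrite ge0_integralZl_EFin//; last 2 first.
- apply/measurable_EFinP; apply: measurable_indic; exact: (measurable_early hE).
- exact: weightC_ge0.
rewrite integral_indic//; last exact: (measurable_early hE).
rewrite [X in (_ * X)%E](_ : _ = (r ^+ k.+1)%:E); last first.
  by rewrite setIT; exact: (early_prob hE L0 k).
rewrite -EFinM lee_fin /c -[leRHS]mulrA -weightE.
rewrite [leLHS](_ : _ = 4 * C * 4 ^+ m * (weight k * r ^+ k) * r); last by rewrite exprS; ring.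
apply: ler_piMr; last exact: ltW.
apply: mulr_ge0; first by rewrite !mulr_ge0// exprn_ge0.
by apply: mulr_ge0; [exact: weight_ge0|exact: exprn_ge0].
Qed.

Let tail_sum C m n w : \bar R := (\sum_(k <oo) (2 * weight k)%:E *
      (jump_tail C (lam n) m k w + jump_tail C (fun=> lambda0) m k w))%E.

Let tail_sum_term_ge0 C m n k w : 0 <= C -> (0 <= (2 * weight k)%:E *
      (jump_tail C (lam n) m k w + jump_tail C (fun=> lambda0) m k w))%E.
Proof.
move=> C0; apply: mule_ge0; first by rewrite lee_fin.
by apply: adde_ge0; exact: jump_tail_ge0.
Qed.

Let measurable_tail_term C m n k : 0 <= C -> measurable_fun [set: T] (fun w =>
  (2 * weight k)%:E * (jump_tail C (lam n) m k w + jump_tail C (fun=> lambda0) m k w))%E.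
Proof.
move=> C0; apply: measurable_funeM; apply: emeasurable_funD;
  exact: measurable_jump_tail.
Qed.

(** Uniform in [n]: [lam n] enters only through its independence of [E] and the bound [M]. The
    constant is [64 = 2 * (16 + 16)]. *)
Let integral_tail_sum C m n : 0 <= C ->
  (\int[P]_w tail_sum C m n w <=
   (64 * C * M * Q / (1 - r / q ^+ 2) * (4^-1) ^+ m)%:E)%E.
Proof.
move=> C0; rewrite integral_nneseries//; last 2 first.
- by move=> k; exact: measurable_tail_term.
- by move=> k w _; exact: tail_sum_term_ge0.
pose c := 64 * C * M * Q * (4^-1) ^+ m.
have c0 : 0 <= c by rewrite !mulr_ge0 ?exprn_ge0// ltW.
apply: (@le_trans _ _ (\sum_(k <oo) (c * (r / q ^+ 2) ^+ k)%:E)%E); last first.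
  apply: le_trans (nneseries_geometric_le c0 rq) _.
  by rewrite lee_fin /c mulrAC.
apply: lee_nneseries => [k _ _|k _].
  by apply: integral_ge0 => w _; exact: tail_sum_term_ge0.
have t1 w := jump_tail_ge0 C0 (lam n) m k w.
have t2 w := jump_tail_ge0 C0 (fun=> lambda0) m k w.
have m1 := measurable_jump_tail C0 m k (mlam n).
have m2 := measurable_jump_tail C0 m k (measurable_cst lambda0 : measurable_fun [set: T] _).
rewrite ge0_integralZl_EFin//; last 2 first.
- by move=> w _; rewrite adde_ge0.
- exact: emeasurable_funD.
rewrite ge0_integralD//.
apply: (@le_trans _ _ ((2 * weight k)%:E *
    ((16 * C * M * (4 ^+ m)^-1 * r ^+ k)%:E + (16 * C * M * (4 ^+ m)^-1 * r ^+ k)%:E))%E).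
  apply: lee_wpmul2l; first by rewrite lee_fin.
  by apply: leeD; exact: integral_jump_tail.
rewrite -EFinD -EFinM lee_fin /c exprVn.
rewrite [leRHS](_ : _ = 64 * C * M * (4 ^+ m)^-1 * (Q * (r / q ^+ 2) ^+ k)); last by ring.
rewrite -weightE le_eqVlt; apply/orP; left; apply/eqP; ring.
Qed.

Lemma integral_increment_cvg0 : (\int[P]_w Y n w)%E @[n --> \oo] --> 0%E.
Proof.
have [C C0 hC] := kernel_pairing_sqr_le b a0 alpha0 bphi.
apply: (almost_dominated_cvg0 mY Y0 Y_cvg0) => e e0.
pose K := 64 * C * M * Q / (1 - r / q ^+ 2).
have K0 : 0 <= K.
  have /andP[_ rq1] := rq.
  apply: divr_ge0; last by rewrite subr_ge0 ltW.
  by rewrite !mulr_ge0// ltW.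
have z01 : `|(4 : R)^-1| < 1 by rewrite ger0_norm// invf_lt1// ltr1n.
have cK : K * (4^-1) ^+ m @[m --> \oo] --> (0 : R) by exact: (@cvg_geometric R K _ z01).
(* [m] is chosen from [e] alone, so that the singular part has integral at most [e] for every
   [n]. *)
have /cvgrPdist_le/(_ _ e0)[m _ /(_ m (leqnn m))/=] := cK.
rewrite sub0r normrN => /(le_trans (ler_norm _)) Km.
exists (early_sum C m), (tail_sum C m); split.
- exact: integrable_early_sum.
- by move=> w; apply: nneseries_ge0 => k _ _; exact: early_sum_term_ge0.
- move=> n; split.
    apply: (ge0_emeasurable_sum (P := xpredT)) => [k w _ _|k _].
      exact: tail_sum_term_ge0.
    exact: measurable_tail_term.
  by move=> w; apply: nneseries_ge0 => k _ _; exact: tail_sum_term_ge0.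
- apply: filterS ae_good => w [E0 _ _ _ _] n.
  exact: Y_le_split.
- by move=> n; apply: le_trans (integral_tail_sum m n C0) _; rewrite lee_fin.
Qed.

(** The measurability of the increment in the outcome is not established; its integral is squeezed
    between [0] and that of the measurable [Y n]. *)
Lemma pairing_Udens_L2_cvg (U0 : T -> {finite_measure set R -> \bar R}) :
  (\int[P]_w ((pairing (Udens a b alpha t (U0 w) E (bet n w) (lam n w) w) phi
     - pairing (Udens a b alpha t (U0 w) E beta0 lambda0 w) phi) ^+ 2)%:E)%E
    @[n --> \oo] --> 0%E.
Proof.
apply: (@squeeze_cvge _ _ _ _ (cst 0%E) _ (fun n => \int[P]_w Y n w)%E).
- apply: nearW => n; apply/andP; split.
    by apply: integral_ge0 => w _; rewrite lee_fin sqr_ge0.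
  apply: ge0_ae_le_integral_nonmeasurable => //.
  - by move=> w; rewrite lee_fin sqr_ge0.
  - exact: pairing_increment_le_ae.
- exact: cvg_cst.
- exact: integral_increment_cvg0.
Qed.

End increments.
End signal.

Unset Implicit Arguments. Set Strict Implicit. Set Printing Implicit Defensive.

Theorem theorem3p3 (R : realType) (a b alpha Delta M beta0 lambda0 : R)
  (d : measure_display) (T : measurableType d) (P : probability T R)
  (U0t : T -> {finite_measure set R -> \bar R})
  (E : nat -> T -> R)
  (beta_hat lambda_hat : nat -> T -> R)
  (phi : R -> R) :
  0 < a -> 0 < alpha -> 0 < Delta ->
  (* theta0 in Theta *)
  0 < beta0 < 1 -> 0 < lambda0 <= M ->
  (* tilde U_0 : X-valued random variable (finite measure on [0,1]) *)
  (forall w, U0t w (~` `[0, 1]) = 0%E) ->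
  (forall A, measurable A -> measurable_fun [set: T] (fun w : T => (U0t w A : \bar R))) ->
  (* tilde N : standard Poisson process (i.i.d. Exp(1) inter-arrival times) *)
  std_poisson_interarrivals P E ->
  (* hat theta_n : Theta-valued estimators, strongly consistent *)
  (forall n, measurable_fun setT (beta_hat n)) ->
  (forall n, measurable_fun setT (lambda_hat n)) ->
  (forall n w, 0 < beta_hat n w < 1 /\ 0 < lambda_hat n w <= M) ->
  {ae P, forall w, beta_hat n w @[n --> \oo] --> beta0 /\
                   lambda_hat n w @[n --> \oo] --> lambda0} ->
  (* tilde N independent of all other random objects (hat theta_n, tilde U_0) *)
  independent_families P E
    (fun j : (nat * bool) + {A : set R | measurable A} => fun w =>
       match j with
       | inl (n, true) => beta_hat n w
       | inl (n, false) => lambda_hat n w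
       | inr A => fine (U0t w (proj1_sig A))
       end) ->
  (* phi bounded continuous on [0,1] *)
  {within `[0, 1], continuous phi} ->
  (exists C : R, forall x, x \in `[0, 1] -> `|phi x| <= C) ->
  (fun n => (\int[P]_w
     ((pairing (Udens a b alpha Delta (U0t w) E (beta_hat n w) (lambda_hat n w) w) phi
       - pairing (Udens a b alpha Delta (U0t w) E beta0 lambda0 w) phi) ^+ 2)%:E)%E)
    @ \oo --> 0%E.
Proof.
move=> a0 alpha0 Delta0 beta01 /andP[l0 lM] _ _ hE mbet mlam adm cvgs ind cphi _.
have bphi := continuous_bounded_measurable cphi.
apply: (@pairing_Udens_L2_cvg _ _ _ P a b alpha Delta M) => //.
- exact: lt_le_trans l0 lM.
- by split=> //; rewrite l0.
- by move=> n; have := independent_families_independent_of (inl (n, false)) ind.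
Qed.
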